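(* Let $A\in\mathbb{R}^{m\times n}$ be a real matrix, and for $y\in\mathbb{R}^m$ let $\Omega(y):=\{x\in\mathbb{R}^n_+ \mid Ax\le y\}$, assumed to be a convex polytope (i.e. compact). Let $g:\mathbb{R}^m\to\mathbb{R}$ be the function $$g(y):=\int_{\Omega(y)}dx=\mathrm{vol}(\Omega(y)),$$ and let $G$ be its $m$-dimensional two-sided Laplace transform, $$G(\lambda):=\int_{\mathbb{R}^m}e^{-\langle\lambda,y\rangle}g(y)\,dy .$$ Assume that $x=0$ is the only solution of the system $\{x\ge 0,\ Ax\le 0\}$. Then $$G(\lambda)=\frac{1}{\prod_{i=1}^m\lambda_i}\times\frac{1}{\prod_{j=1}^n(A'\lambda)_j}\qquad\text{for all }\lambda\in\mathbb{C}^m\text{ with }\Re(\lambda)>0\text{ and }\Re(A'\lambda)>0 .$$ Moreover, $$g(y)=\frac{1}{(2\pi i)^m}\int_{c_1-i\infty}^{c_1+i\infty}\cdots\int_{c_m-i\infty}^{c_m+i\infty}e^{\langle\lambda,y\rangle}G(\lambda)\,d\lambda ,$$ where the real vector $c=(c_1,\dots,c_m)\in\mathbb{R}^m$ satisfies $c>0$ and $A'c>0$.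
   Context: $\mathbb{R}_+=[0,\infty)$. $A'$ denotes the transpose of $A$, and $(A'\lambda)_j$ is the $j$-th coordinate of $A'\lambda\in\mathbb{C}^n$. Inequalities between vectors ($\ge$, $\le$, $>$) are componentwise, and $\Re(\cdot)$ of a complex vector is taken componentwise. For $\lambda\in\mathbb{C}^m$ and $y\in\mathbb{R}^m$, $\langle\lambda,y\rangle=\sum_{i=1}^m\lambda_i y_i$ (bilinear, no conjugation). $\mathrm{vol}$ is the $n$-dimensional Lebesgue volume (equal to $0$ if the set is empty). In the inversion formula, the variable $\lambda_k$ is integrated along the vertical line $\Re(\lambda_k)=c_k$ in $\mathbb{C}$, for $k=1,\dots,m$; this is the usual inverse Laplace transform.
   Formalization: The inversion formula is stated for every y if A has no zero row, and otherwise only at y where g is continuous; it fails elsewhere: for A=(1,0)', y=(1,0), g(y)=1 but the inverse integral gives 1/2. *)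

(* Defs.v *)
From HB Require Import structures.
From mathcomp Require Import all_boot all_order all_algebra.
From mathcomp Require Import all_classical all_reals all_analysis.
From mathcomp Require Import complex.

Set Implicit Arguments.
Unset Strict Implicit.
Unset Printing Implicit Defensive.

Import Order.TTheory GRing.Theory Num.Theory.
Import numFieldNormedType.Exports.

Local Open Scope classical_set_scope.
Local Open Scope ring_scope.
Local Open Scope complex_scope.

Section sigma_finite_pack.
Context d (T : measurableType d) (R : realType) (m : {measure set T -> \bar R}).
Hypothesis sfm : sigma_finite setT m.

Let m' of sigma_finite setT m : set T -> \bar R := m.

HB.instance Definition _ := Measure.on (m' sfm).
HB.instance Definition _ := Measure_isSigmaFinite.Build _ _ _ (m' sfm) sfm.

Lemma sigma_finite_measure_pack :
  exists mu : {sigma_finite_measure set T -> \bar R},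
    (m : set T -> \bar R) = mu.
Proof. by exists (m' sfm). Qed.

End sigma_finite_pack.

Section tuple_lebesgue.
Variable R : realType.

Local Notation mR := (measurableTypeR R).

(* n-dimensional Lebesgue measure on the Borel sets of R^n, as the n-fold
   product of the one-dimensional one (in dimension 0, a unit mass). *)
Fixpoint tuple_lebesgue (n : nat) : set (n.-tuple mR) -> \bar R :=
  if n is k.+1 then
    fun B => (\int[@lebesgue_measure R]_x
                @tuple_lebesgue k [set t : k.-tuple mR | B (cons_tuple x t)])%E
  else fun B => \d_([tuple] : 0.-tuple mR) B.

Let consp k (p : mR * k.-tuple mR) : k.+1.-tuple mR := cons_tuple p.1 p.2.

Let measurable_consp k : measurable_fun setT (@consp k).
Proof. exact: measurable_cons. Qed.

Lemma tuple_lebesgue_spec n :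
  exists mu : {sigma_finite_measure set (n.-tuple mR) -> \bar R},
    @tuple_lebesgue n = mu :> (set (n.-tuple mR) -> \bar R).
Proof.
elim: n => [|n [mu mu_eq]]; first by exists (\d_([tuple] : 0.-tuple mR)).
pose P : {measure set (mR * n.-tuple mR)%type -> \bar R} :=
  (@lebesgue_measure R \x mu)%E.
pose Q : set (n.+1.-tuple mR) -> \bar R := pushforward P (@consp n).
have QE : @tuple_lebesgue n.+1 = Q.
  apply/funext => B /=; apply: eq_integral => x _ /=.
  rewrite mu_eq; congr (mu _); apply/funext => t /=.
  by rewrite /xsection /= inE.
have Qsf : sigma_finite setT Q.
  have /sigma_finiteP[F [FT Fnd Foo]] := sigma_finiteT (@lebesgue_measure R).
  have /sigma_finiteP[G [GT Gnd Goo]] := sigma_finiteT mu.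
  pose d (t : n.+1.-tuple mR) : mR * n.-tuple mR :=
    (tnth t ord0, [tuple of behead t]).
  have md : measurable_fun setT d.
    apply: measurable_fun_pair; first exact: measurable_tnth.
    exact: measurable_behead.
  have dK : cancel (@consp n) d.
    by case=> x t; congr (_, _); apply: val_inj.
  exists (fun k => d @^-1` (F k `*` G k)).
    apply/esym/seteqP; split=> // t _.
    have [i _ Fi] : (\bigcup_i F i) (d t).1 by rewrite -FT.
    have [j _ Gj] : (\bigcup_j G j) (d t).2 by rewrite -GT.
    exists (maxn i j) => //; split.
      by move: Fi; apply/subsetPset/Fnd/leq_maxl.
    by move: Gj; apply/subsetPset/Gnd/leq_maxr.
  move=> k; have [mF Fk] := Foo k; have [mG Gk] := Goo k; split.
    by rewrite -[X in measurable X]setTI; apply: md => //; exact: measurableX.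
  have -> : Q (d @^-1` (F k `*` G k)) = P (F k `*` G k).
    rewrite /Q /pushforward; congr (P _).
    by rewrite -comp_preimage (_ : d \o _ = id) //; apply/funext => p; exact: dK.
  by rewrite /P /= product_measure1E// lte_mul_pinfty// ge0_fin_numE.
pose Q' : {measure set (n.+1.-tuple mR) -> \bar R} := pushforward P (@consp n).
pose Qm := Q' (@measurable_consp n).
by rewrite QE; exact: (@sigma_finite_measure_pack _ _ _ Qm).
Qed.

Variable n : nat.

Let tuple_lebesgue0 : @tuple_lebesgue n set0 = 0%E.
Proof. by have [mu ->] := tuple_lebesgue_spec n; exact: measure0. Qed.

Let tuple_lebesgue_ge0 B : (0 <= @tuple_lebesgue n B)%E.
Proof. by have [mu ->] := tuple_lebesgue_spec n; exact: measure_ge0. Qed.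

Let tuple_lebesgue_additive : semi_sigma_additive (@tuple_lebesgue n).
Proof.
by have [mu ->] := tuple_lebesgue_spec n; exact: measure_semi_sigma_additive.
Qed.

HB.instance Definition _ := isMeasure.Build _ _ _ (@tuple_lebesgue n)
  tuple_lebesgue0 tuple_lebesgue_ge0 tuple_lebesgue_additive.

Let tuple_lebesgue_sigma_finite : sigma_finite setT (@tuple_lebesgue n).
Proof. by have [mu ->] := tuple_lebesgue_spec n; exact: sigma_finiteT. Qed.

HB.instance Definition _ := Measure_isSigmaFinite.Build _ _ _
  (@tuple_lebesgue n) tuple_lebesgue_sigma_finite.

End tuple_lebesgue.
Arguments tuple_lebesgue {R} n.

Section complex_integration.
Variable R : realType.

Definition cexp (z : R[i]) : R[i] :=
  (expR (complex.Re z))%:C *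
  (cos (complex.Im z) +i* sin (complex.Im z)).

Context d (T : measurableType d) (mu : {measure set T -> \bar R}).

Definition cintegrable (D : set T) (f : T -> R[i]) : Prop :=
  mu.-integrable D (EFin \o (fun x => complex.Re (f x))) /\
  mu.-integrable D (EFin \o (fun x => complex.Im (f x))).

Definition cintegral (D : set T) (f : T -> R[i]) : R[i] :=
  (\int[mu]_(x in D) complex.Re (f x)) +i* (\int[mu]_(x in D) complex.Im (f x)).

End complex_integration.

Section laplace.
Variable R : realType.

(* The library puts a sigma-algebra on tuples and a topology and linear algebra
   on column vectors; this identifies the two copies of R^n. *)
Definition col_of_tuple n (t : n.-tuple R) : 'cV[R]_n := \col_i tnth t i.

(* <lambda, y>, bilinear: no conjugation *)
Definition pairing m (l : 'cV[R[i]]_m) (y : 'cV[R]_m) : R[i] :=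
  \sum_(i < m) l i 0 * (y i 0)%:C.

Definition laplace_integrand m (f : 'cV[R]_m -> R) (l : 'cV[R[i]]_m)
    (t : m.-tuple R) : R[i] :=
  cexp (- pairing l (col_of_tuple t)) * (f (col_of_tuple t))%:C.

Definition laplace_converges m (f : 'cV[R]_m -> R) (l : 'cV[R[i]]_m) : Prop :=
  cintegrable (tuple_lebesgue m) setT (laplace_integrand f l).

Definition laplace m (f : 'cV[R]_m -> R) (l : 'cV[R[i]]_m) : R[i] :=
  cintegral (tuple_lebesgue m) setT (laplace_integrand f l).

(* v is the limit, as T -> +oo, of the integral of F(z) dz along the segment
   from c - iT to c + iT, parametrized by z = c + it, dz = i dt. *)
Definition is_vline_integral (c : R) (F : R[i] -> R[i]) (v : R[i]) : Prop :=
  let h (t : R) := 'i%C * F (c +i* t) in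
  let I (T : R) := cintegral (@lebesgue_measure R) `[- T, T] h in
  [/\ forall T : R, cintegrable (@lebesgue_measure R) `[- T, T] h,
      complex.Re (I T) @[T --> +oo] --> complex.Re v &
      complex.Im (I T) @[T --> +oo] --> complex.Im v].

(* v is the iterated integral of f(z_1, .., z_m) over the lines Re z_k = c_k,
   the outermost integral being the one in z_1; all the intermediate integrals
   are required to exist. *)
Fixpoint is_iterated_vline_integral (m : nat) :
    'cV[R]_m -> ('cV[R[i]]_m -> R[i]) -> R[i] -> Prop :=
  if m is k.+1 then fun (c : 'cV[R]_(1 + k)) f v =>
    exists2 F : R[i] -> R[i],
      forall t : R, let z := c 0 0 +i* t in
        is_iterated_vline_integral (dsubmx c)
          (fun l : 'cV[R[i]]_k => f (col_mx (z%:M : 'cV[R[i]]_1) l)) (F z) &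
      is_vline_integral (c 0 0) F v
  else fun _ f v => v = f 0.

End laplace.

Section polyhedron.
Variables (R : realType) (m n : nat) (A : 'M[R]_(m, n)).

Definition Omega (y : 'cV[R]_m) : set 'cV[R]_n :=
  [set x : 'cV[R]_n | (forall j, 0 <= x j 0) /\ (forall i, (A *m x) i 0 <= y i 0)].

Definition vol (B : set 'cV[R]_n) : \bar R :=
  tuple_lebesgue n [set t | B (col_of_tuple t)].

(* [fine] maps +oo to 0; a compact Omega y has finite volume. *)
Definition vol_Omega (y : 'cV[R]_m) : R := fine (vol (Omega y)).

Definition ctrmul (l : 'cV[R[i]]_m) : 'cV[R[i]]_n :=
  (map_mx (real_complex R) A)^T *m l.

End polyhedron.

(* Main.v *)
(** The volume is g(y) = int_(x >= 0) prod_i 1[(Ax)_i <= y_i] dx. Inserting this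
    in the Laplace transform and integrating first in y, coordinate by
    coordinate, then in x gives the product formula; absolute convergence holds
    because |exp(- <A'lambda, x>)| is integrable on the orthant.

    For the inversion, G(lambda) exp <lambda, y> is
    int_(x >= 0) prod_i exp(lambda_i b_i(x)) / lambda_i dx, b_i(x) = y_i - (Ax)_i.
    By Fubini, each integral over a vertical line can be carried out inside the
    x-integral, where it only meets the truncated Bromwich integral of
    exp(z u) / z. The latter tends to 2 pi i H(u), where H is the Heaviside
    function with H(0) = 1/2, and is bounded by C exp(c u) uniformly in the
    truncation, so that dominated convergence applies. The outcome is
    (2 pi i)^m int_(x >= 0) prod_i H(b_i(x)) dx, which differs from g(y) at most by
    the contribution of the hyperplanes (Ax)_i = y_i: these are null when the rows
    of A are nonzero, and in general the integral lies between g(y - e) and g(y)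
    for all e > 0. *)

Require Import Defs.
From mathcomp Require Import all_boot all_order all_algebra.
From mathcomp Require Import all_classical all_reals all_analysis.
From mathcomp Require Import measurable_realfun complex.
From mathcomp Require Import ring lra.

Set Implicit Arguments.
Unset Strict Implicit.
Unset Printing Implicit Defensive.

Import Order.TTheory GRing.Theory Num.Theory.
Import numFieldNormedType.Exports.

Local Open Scope classical_set_scope.
Local Open Scope ring_scope.
Local Open Scope complex_scope.

(** * The truncated Bromwich integral of exp(z u) / z *)

(** The limit of the truncated Bromwich integral and its uniform bound are obtained by real calculus
    in the abscissa s, without contours. At fixed T the s-derivative only involves the endpoints and
    is O(exp(s u) / T), the usual estimate for the horizontal sides of a rectangle. For u < 0 the
    line is pushed to s = +oo, where the integral vanishes. For u > 0 this is impossible and the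
    pole blocks the other direction; adding the integral for - u, to which the first case applies,
    gives a quantity that is nearly constant in s and can be computed as s tends to 0, where it is 4
    atan(T / s) up to O(s). This is where pi comes from.

    Since 1 / z is not integrable on a vertical line, the line integrals only exist as symmetric
    limits. Fubini is therefore applied on [-T, T], before the limit, and the bound must be uniform
    in T and remain integrable in x. The bound C exp(c u) is of this kind, because the product of
    the exp(c_i b_i(x)) is exp(<c, y>) exp(- <A'c, x>). *)

Section truncated_bromwich.
Variable R : realType.
Implicit Types u s t c T : R.

Local Notation mu := (@lebesgue_measure R).

Lemma Rintegral_FTC2 (f F : R -> R) (a b : R) : a <= b ->
  continuous f -> (forall x : R, is_derive x (1 : R) F (f x)) ->
  \int[mu]_(x in `[a, b]) f x = F b - F a.
Proof.
rewrite le_eqVlt => /predU1P[<-|ab] cf dF.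
  by rewrite set_itv1 Rintegral_set1 subrr.
have cF : continuous F.
  by move=> x; apply/differentiable_continuous/derivable1_diffP; case: (dF x).
rewrite /Rintegral (@continuous_FTC2 _ f F)//.
- by apply: continuous_subspaceT => x; exact: cf.
- split.
  + by move=> x _; case: (dF x).
  + by apply: cvg_at_right_filter; exact: cF.
  + by apply: cvg_at_left_filter; exact: cF.
- by move=> x _; rewrite derive1E; exact: derive_val.
Qed.

(* [brw_re] and [brw_im] are the real and imaginary parts of exp(z u) / z at
   z = s + it; [brw_der] is the s-derivative of the former, hence by
   Cauchy-Riemann the t-derivative of the latter. *)
Definition brw_re u s t : R :=
  expR (s * u) * (s * cos (t * u) + t * sin (t * u)) * (s ^+ 2 + t ^+ 2)^-1.

Definition brw_im u s t : R :=
  expR (s * u) * (s * sin (t * u) - t * cos (t * u)) * (s ^+ 2 + t ^+ 2)^-1.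

Definition brw_der u s t : R :=
  u * brw_re u s t +
  expR (s * u) * (cos (t * u)) * (s ^+ 2 + t ^+ 2)^-1 -
  2 * s * brw_re u s t * (s ^+ 2 + t ^+ 2)^-1.

Lemma sqr_add_gt0 s t : 0 < s -> 0 < s ^+ 2 + t ^+ 2.
Proof. by move=> s0; rewrite ltr_wpDr ?sqr_ge0// exprn_gt0. Qed.

Lemma is_derive_brw_re u s t : 0 < s ->
  is_derive s 1 (fun s => brw_re u s t) (brw_der u s t).
Proof.
move=> s0; have N0 := lt0r_neq0 (sqr_add_gt0 t s0).
rewrite /brw_re; apply: is_derive_eq.
rewrite /brw_der /brw_re /GRing.scale/=.
field.
done.
Qed.

Lemma is_derive_brw_im u s t : 0 < s ->
  is_derive t 1 (brw_im u s) (brw_der u s t).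
Proof.
move=> s0; have N0 := lt0r_neq0 (sqr_add_gt0 t s0).
rewrite /brw_im; apply: is_derive_eq.
rewrite /brw_der /brw_re /GRing.scale/=.
field.
done.
Qed.

Lemma continuous_brw_re u s : 0 < s -> continuous (brw_re u s).
Proof.
move=> s0 t; have N0 := lt0r_neq0 (sqr_add_gt0 t s0).
apply/differentiable_continuous/derivable1_diffP.
rewrite /brw_re.
by apply: ex_derive.
Qed.

Lemma continuous_brw_der u s : 0 < s -> continuous (brw_der u s).
Proof.
move=> s0 t; have N0 := lt0r_neq0 (sqr_add_gt0 t s0).
apply/differentiable_continuous/derivable1_diffP.
rewrite /brw_der /brw_re.
by apply: ex_derive.
Qed.

(** Reduces to x (x + |y|) <= 2 (x^2 + y^2), a consequence of (x - |y|)^2 >= 0. With x the abscissa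
    it gives the factor 2 / s for [brw_re]; with x the ordinate it gives the factor 2 / t for
    [brw_im], the decay that makes the endpoint terms vanish. *)
Lemma norm_lin_div_sqr_le (a b x y : R) : 0 < x -> `|a| <= 1 -> `|b| <= 1 ->
  `|x * a + y * b| / (x ^+ 2 + y ^+ 2) <= 2 / x.
Proof.
move=> x0 a1 b1; rewrite ler_pdivrMr ?sqr_add_gt0//.
have h : `|x * a + y * b| <= x + `|y|.
  rewrite (le_trans (ler_normD _ _))// !normrM (gtr0_norm x0).
  by rewrite lerD// ler_piMr// ltW.
rewrite (le_trans h)// mulrAC ler_pdivlMr//.
have := sqr_ge0 (x - `|y|); rewrite -[y ^+ 2]real_normK ?num_real//.
by have := normr_ge0 y; nra.
Qed.

Lemma norm_brw_re_le u s t : 0 < s -> `|brw_re u s t| <= expR (s * u) * (2 / s).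
Proof.
move=> s0; rewrite /brw_re !normrM normfV (gtr0_norm (expR_gt0 _)).
rewrite (gtr0_norm (sqr_add_gt0 t s0)) -mulrA ler_wpM2l ?expR_ge0//.
by rewrite norm_lin_div_sqr_le ?cos_max ?sin_max.
Qed.

Lemma norm_brw_im_le u s t : 0 < t -> `|brw_im u s t| <= expR (s * u) * (2 / t).
Proof.
move=> t0; rewrite /brw_im !normrM normfV (gtr0_norm (expR_gt0 _)).
rewrite addrC [_ ^+ 2 + _]addrC (gtr0_norm (sqr_add_gt0 s t0)) -mulrA.
rewrite ler_wpM2l ?expR_ge0// -mulrN.
by rewrite norm_lin_div_sqr_le ?normrN ?cos_max ?sin_max.
Qed.

(** Uniform in t and locally uniform in s: the domination required to differentiate under the
    integral sign. The 5 is 1 + 4, from [p2] and [p3]. *)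
Lemma norm_brw_der_le u s t v w : 0 < v -> v <= s -> s <= w ->
  `|brw_der u s t| <= expR (w * `|u|) * (2 * `|u| / v + 5 / v ^+ 2).
Proof.
move=> v0 vs sw; have s0 : 0 < s by exact: lt_le_trans vs.
have N0 := sqr_add_gt0 t s0.
have Nv : (s ^+ 2 + t ^+ 2)^-1 <= (v ^+ 2)^-1.
  rewrite lef_pV2 ?posrE ?exprn_gt0//.
  by rewrite ler_wpDr ?sqr_ge0// lerXn2r// ?nnegrE ltW.
have E0 := expR_ge0 (w * `|u|).
have EE : expR (s * u) <= expR (w * `|u|).
  rewrite ler_expR (le_trans (ler_norm _))// normrM (gtr0_norm s0).
  by rewrite ler_wpM2r.
have sV : s^-1 <= v^-1 by rewrite lef_pV2 ?posrE.
have re_le := norm_brw_re_le u t s0.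
have re_le' : `|brw_re u s t| <= expR (w * `|u|) * (2 / v).
  rewrite (le_trans re_le)// ler_pM ?expR_ge0 ?mulr_ge0 ?invr_ge0 ?ler_wpM2l//.
  exact: ltW.
have NV0 : 0 <= (s ^+ 2 + t ^+ 2)^-1 by rewrite invr_ge0 ltW.
have p1 : `|u * brw_re u s t| <= expR (w * `|u|) * (2 * `|u| / v).
  rewrite normrM (le_trans (ler_wpM2l _ re_le'))//.
  by rewrite le_eqVlt; apply/orP; left; apply/eqP; ring.
have p2 : `|expR (s * u) * cos (t * u) * (s ^+ 2 + t ^+ 2)^-1| <=
    expR (w * `|u|) * (1 / v ^+ 2).
  rewrite !normrM normfV (gtr0_norm (expR_gt0 _)) (gtr0_norm N0) -mulrA.
  rewrite ler_pM ?expR_ge0//; first by rewrite mulr_ge0.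
  by rewrite ler_pM ?cos_max.
have p3 : `|2 * s * brw_re u s t * (s ^+ 2 + t ^+ 2)^-1| <=
    expR (w * `|u|) * (4 / v ^+ 2).
  move: (brw_re u s t) re_le {re_le' p1} => r re_le.
  rewrite !normrM normfV (gtr0_norm N0) (gtr0_norm s0) gtr0_norm//.
  apply: (@le_trans _ _ (2 * s * (expR (s * u) * (2 / s)) * (v ^+ 2)^-1)).
    have s20 : 0 <= 2 * s by rewrite mulr_ge0// ltW.
    by rewrite ler_pM// ?ler_wpM2l// mulr_ge0.
  have -> : 2 * s * (expR (s * u) * (2 / s)) * (v ^+ 2)^-1 =
            expR (s * u) * (4 / v ^+ 2).
    by field; rewrite !lt0r_neq0.
  by rewrite ler_wpM2r// mulr_ge0// invr_ge0 exprn_ge0// ltW.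
have -> : expR (w * `|u|) * (2 * `|u| / v + 5 / v ^+ 2) =
    expR (w * `|u|) * (2 * `|u| / v) + expR (w * `|u|) * (1 / v ^+ 2) +
    expR (w * `|u|) * (4 / v ^+ 2) by ring.
rewrite /brw_der (le_trans (ler_normB _ _))// lerD//.
by rewrite (le_trans (ler_normD _ _))// lerD.
Qed.

Lemma integrable_itv_continuous (f : R -> R) (a b : R) : continuous f ->
  mu.-integrable `[a, b] (EFin \o f).
Proof.
move=> cf; apply: continuous_compact_integrable; first exact: segment_compact.
by apply: continuous_subspaceT => x; exact: cf.
Qed.

Definition brw T u s : R := \int[mu]_(t in `[- T, T]) brw_re u s t.

(* Cauchy-Riemann turns the s-derivative of the integrand into a t-derivative,
   so that only the endpoints t = T and t = - T contribute. *)
Lemma is_derive_brw T u s : 0 < T -> 0 < s ->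
  is_derive s (1 : R) (brw T u) (2 * brw_im u s T).
Proof.
move=> T0 s0.
have s2 : 0 < s / 2 by rewrite divr_gt0.
pose G := expR (s * 2 * `|u|) * (2 * `|u| / (s / 2) + 5 / (s / 2) ^+ 2).
have dE x y : 0 < x -> partial1of2 (brw_re u) x y = brw_der u x y.
  move=> x0; rewrite partial1of2E.
  exact: (@derive_val _ _ _ _ _ _ _ (is_derive_brw_re u y x0)).
have Ip x : `]s / 2, s * 2[%classic x -> 0 < x.
  by rewrite /= in_itv/= => /andP[+ _]; exact: lt_trans.
have H1 x : `]s / 2, s * 2[%classic x ->
    mu.-integrable `[- T, T] (EFin \o brw_re u x).
  by move=> /Ip x0; apply/integrable_itv_continuous/continuous_brw_re.
have H2 x y : `]s / 2, s * 2[%classic x -> `[- T, T]%classic y ->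
    derivable (brw_re u ^~ y) x 1.
  by move=> /Ip x0 _; case: (is_derive_brw_re u y x0).
have H3 (x y : R) : `]s / 2, s * 2[%classic x -> `[- T, T]%classic y ->
    `|partial1of2 (brw_re u) x y| <= G.
  move=> xI _; rewrite dE; last exact: Ip.
  move: xI; rewrite /= in_itv/= => /andP[xl xr].
  by apply: norm_brw_der_le => //; exact: ltW.
have sI : `]s / 2, s * 2[%classic s by rewrite /= in_itv/=; apply/andP; lra.
have mI : measurable (`[- T, T]%classic : set (measurableTypeR R)) by [].
have G0 : 0 <= G.
  by rewrite mulr_ge0 ?expR_ge0// addr_ge0// !mulr_ge0// invr_ge0 ?exprn_ge0// ltW.
have iG : mu.-integrable `[- T, T] (EFin \o cst G).
  by apply: integrable_itv_continuous; exact: cst_continuous.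
have der := @derivable_under_integral _ _ _ mu _ _ mI _ _ _ sI H1 H2
  (cst G) (fun=> G0) iG H3.
have val := @differentiation_under_integral _ _ _ mu _ _ mI _ _ _ sI H1 H2
  (cst G) (fun=> G0) iG H3.
apply: DeriveDef; first exact: der.
rewrite -derive1E [LHS]val.
transitivity (\int[mu]_(t in `[- T, T]) brw_der u s t).
  by apply: eq_Rintegral => t _; rewrite dE.
have TT : - T <= T by rewrite ge0_cp// ltW.
rewrite (Rintegral_FTC2 TT (@continuous_brw_der u s s0)
  (fun x => is_derive_brw_im u x s0)).
(* [brw_im] is odd in t, so the two endpoints contribute equally. *)
by rewrite /brw_im sqrrN mulNr cosN sinN; ring.
Qed.
(** Both [g \- f] and [g \+ f] are nondecreasing. A variable bound [dg] is allowed because in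
    [brw_neg_le] the factor 1 / |u| is gained by integrating exp(s u) in s. *)
Lemma norm_increment_le (f g df dg : R -> R) (a b : R) : a <= b ->
  (forall x, a <= x -> is_derive x (1 : R) f (df x)) ->
  (forall x, a <= x -> is_derive x (1 : R) g (dg x)) ->
  (forall x, a <= x <= b -> `|df x| <= dg x) ->
  `|f b - f a| <= g b - g a.
Proof.
move=> ab df' dg' le.
have cts (h dh : R -> R) : (forall x, a <= x -> is_derive x (1 : R) h (dh x)) ->
    {within `[a, b], continuous h}.
  move=> H; apply: continuous_in_subspaceT => x /[!inE]/= /[!in_itv]/= /andP[ax _].
  by apply/differentiable_continuous/derivable1_diffP; case: (H x ax).
have aux (h dh : R -> R) : (forall x, a <= x -> is_derive x (1 : R) h (dh x)) ->
    (forall x, a <= x <= b -> 0 <= dh x) -> h a <= h b.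
  move=> H dh0.
  have H' x : x \in `]a, b[%R -> is_derive x (1 : R) h (dh x).
    by rewrite in_itv/= => /andP[/ltW ax _]; exact: H.
  have [x + hE] := MVT_segment ab H' (cts _ _ H).
  rewrite -subr_ge0 hE in_itv/= => xab.
  by rewrite mulr_ge0 ?subr_ge0// dh0.
have h1 : (g \- f) a <= (g \- f) b.
  apply: (aux _ (dg \- df)) => x xab; first exact: is_deriveB (dg' _ xab) (df' _ xab).
  by rewrite subr_ge0 (le_trans _ (le _ xab))// ler_norm.
have h2 : (g \+ f) a <= (g \+ f) b.
  apply: (aux _ (dg \+ df)) => x xab; first exact: is_deriveD (dg' _ xab) (df' _ xab).
  by rewrite -lerBlDr sub0r (le_trans _ (le _ xab))// ler_normr lexx orbT.
by move: h1 h2 => /=; rewrite ler_norml; lra.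
Qed.

Lemma norm_Rintegral_itv_le (f : R -> R) (K T : R) : 0 <= T -> continuous f ->
  (forall x, `|f x| <= K) -> `|\int[mu]_(x in `[- T, T]) f x| <= K * (2 * T).
Proof.
move=> T0 cf fK; have TT : - T <= T by rewrite ge0_cp.
rewrite (le_trans (le_normr_Rintegral _ _))//; first exact: integrable_itv_continuous.
have -> : K * (2 * T) = \int[mu]_(x in `[- T, T]) cst K x.
  have dK (x : R) : is_derive x (1 : R) (fun x => K * x) (cst K x).
    by apply: is_derive_eq; rewrite /GRing.scale/= mulr1.
  by rewrite (Rintegral_FTC2 TT (@cst_continuous _ _ K) dK); ring.
apply: le_Rintegral => //.
- apply: integrable_itv_continuous => x.
  by apply: cvg_norm; exact: cf.
- by apply: integrable_itv_continuous; exact: cst_continuous.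

Qed.

(** The line is moved right to an abscissa b, where the integral is at most 4 T / b because exp(b u)
    <= 1. The move costs at most the integral of 4 / T exp(s u) over s >= c, which is the stated
    bound; then b tends to +oo. *)
Lemma brw_neg_le T u c : 0 < T -> 0 < c -> u < 0 ->
  `|brw T u c| <= expR (c * u) * (4 / (- u * T)).
Proof.
move=> T0 c0 u0.
have step b : c <= b -> `|brw T u c| <= expR (c * u) * (4 / (- u * T)) + 4 * T / b.
  move=> cb; have b0 : 0 < b by exact: lt_le_trans cb.
  have h1 : `|brw T u b| <= 4 * T / b.
    have -> : 4 * T / b = 2 / b * (2 * T) by field; rewrite lt0r_neq0.
    apply: norm_Rintegral_itv_le; [exact: ltW|exact: continuous_brw_re|] => t.
    rewrite (le_trans (norm_brw_re_le _ _ b0))// ler_piMl ?divr_ge0 1?ltW//.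
    by rewrite -expR0 ltr_expR pmulr_rlt0.
  have h2 : `|brw T u b - brw T u c| <=
      4 / (u * T) * expR (b * u) - 4 / (u * T) * expR (c * u).
    apply: (@norm_increment_le (brw T u) (fun x => 4 / (u * T) * expR (x * u))
      (fun s => 2 * brw_im u s T) (fun s => 4 / T * expR (s * u))) => // x.
    - by move=> cx; apply: is_derive_brw => //; exact: lt_le_trans cx.
    - move=> cx; apply: is_derive_eq; rewrite /GRing.scale/=.
      by field; rewrite lt0r_neq0 ?ltr0_neq0.
    - move=> /andP[cx _]; rewrite normrM ger0_norm//.
      rewrite (le_trans (ler_wpM2l _ (norm_brw_im_le _ _ T0)))//.
      by rewrite le_eqVlt; apply/orP; left; apply/eqP; ring.
  have h3 : 4 / (u * T) * expR (b * u) <= 0.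
    by rewrite mulr_le0_ge0 ?expR_ge0// mulr_ge0_le0// invr_le0 mulr_le0_ge0// ltW.
  have h4 : 4 / (- u * T) = - (4 / (u * T)) by field; rewrite lt0r_neq0 ?ltr0_neq0.
  rewrite h4; move: h1 h2; rewrite !ler_norml => /andP[p1 p2] /andP[q1 q2].
  by apply/andP; lra.
apply/ler_addgt0Pr => e e0.
pose b := Num.max c (4 * T / e).
have cb : c <= b by rewrite /b le_max lexx.
have eb : 4 * T / e <= b by rewrite /b le_max lexx orbT.
apply: (le_trans (step b cb)); rewrite lerD2l ler_pdivrMr ?(lt_le_trans c0)//.
by rewrite -ler_pdivrMl// mulrC.
Qed.

(* Up to sign, [brw T (- u) s] is the same integral taken on the line Re z = - s,
   so that [brw_sum] measures the residue of exp(z u) / z at 0. *)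
Definition brw_sum T u s : R := brw T u s + brw T (- u) s.

(** Each of the two endpoint terms is at most 4 exp(c |u|) / T, whence the 8. The bound is free of
    [a], which can thus tend to 0 at fixed T. *)
Lemma brw_sum_increment T u a c : 0 < T -> 0 < a -> a <= c ->
  `|brw_sum T u c - brw_sum T u a| <= 8 * c * expR (c * `|u|) / T.
Proof.
move=> T0 a0 ac; have c0 : 0 < c by exact: lt_le_trans ac.
pose k := 8 * expR (c * `|u|) / T.
have k0 : 0 <= k by rewrite !mulr_ge0 ?expR_ge0// invr_ge0 ltW.
apply: (@le_trans _ _ (k * c - k * a)); last first.
  have -> : 8 * c * expR (c * `|u|) / T = k * c by rewrite /k; ring.
  by rewrite gerBl mulr_ge0// ltW.
apply: (@norm_increment_le (brw_sum T u) (fun x => k * x)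
  (fun s => 2 * brw_im u s T + 2 * brw_im (- u) s T) (fun=> k)) => // x.
- move=> ax; have x0 : 0 < x by exact: lt_le_trans ax.
  exact: is_deriveD (is_derive_brw u T0 x0) (is_derive_brw (- u) T0 x0).
- by move=> ax; apply: is_derive_eq; rewrite /GRing.scale/= mulr1.
- move=> /andP[ax xc]; have x0 : 0 < x by exact: lt_le_trans ax.
  have h v : `|v| = `|u| -> `|2 * brw_im v x T| <= 4 * expR (c * `|u|) / T.
    move=> vu; rewrite normrM ger0_norm//.
    rewrite (le_trans (ler_wpM2l _ (norm_brw_im_le _ _ T0)))//.
    have -> : 2 * (expR (x * v) * (2 / T)) = 4 * expR (x * v) / T by ring.
    rewrite ler_wpM2r ?invr_ge0 ?(ltW T0)// ler_wpM2l// -vu.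
    rewrite ler_expR (le_trans (ler_norm _))// normrM (gtr0_norm x0).
    by rewrite ler_wpM2r.
  rewrite (le_trans (ler_normD _ _))//.
  have -> : k = 4 * expR (c * `|u|) / T + 4 * expR (c * `|u|) / T.
    by rewrite /k; ring.
  by rewrite lerD// h// normrN.
Qed.
End truncated_bromwich.

(** * The symmetrized integral as the line approaches the pole *)

Section bromwich_small_abscissa.
Variable R : realType.
Implicit Types u s t c T : R.
Local Notation mu := (@lebesgue_measure R).

Lemma Rintegral_cauchy_kernel (a T : R) : 0 < a -> 0 <= T ->
  \int[mu]_(t in `[- T, T]) (a * (a ^+ 2 + t ^+ 2)^-1) = 2 * atan (T / a).
Proof.
move=> a0 T0; have TT : - T <= T by rewrite ge0_cp.
have N0 t : a ^+ 2 + t ^+ 2 != 0 by rewrite lt0r_neq0 ?sqr_add_gt0.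
have dA (t : R) : is_derive t (1 : R) (fun t => atan (t / a)) (a * (a ^+ 2 + t ^+ 2)^-1).
  apply: is_derive_eq; rewrite /GRing.scale/=; field.
  rewrite N0 lt0r_neq0//=.
rewrite (Rintegral_FTC2 TT _ dA) ?mulNr ?atanN; first by ring.
move=> t; have N0t := N0 t.
apply/differentiable_continuous/derivable1_diffP; exact: ex_derive.
Qed.

Lemma norm_expR_subN_le (y : R) : `|expR y - expR (- y)| <= 2 * `|y| * expR `|y|.
Proof.
wlog y0 : y / 0 <= y.
  move=> H; have [/H//|/ltW] := leP 0 y.
  by rewrite -oppr_ge0 => /H; rewrite opprK normrN distrC.
rewrite (ger0_norm y0) ger0_norm; last by rewrite subr_ge0 ler_expR; lra.
have := expR_ge1Dx (- (2 * y)); have := expR_gt0 y.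
have -> : expR (- y) = expR (- (2 * y)) * expR y by rewrite -expRD; congr expR; ring.
nra.
Qed.

Lemma norm_sin_le (x : R) : `|sin x| <= `|x|.
Proof.
wlog x0 : x / 0 <= x.
  move=> H; have [/H//|/ltW] := leP 0 x.
  by rewrite -oppr_ge0 => /H; rewrite sinN !normrN.
have := @norm_increment_le R (@sin R) id (@cos R) (cst 1) 0 x x0.
rewrite sin0 !subr0 (ger0_norm x0); apply.
by move=> y _; exact: cos_max.
Qed.

Lemma norm_cos_sub1_le (x : R) : `|cos x - 1| <= x ^+ 2 / 2.
Proof.
have -> : cos x - 1 = - (2 * sin (x / 2) ^+ 2).
  rewrite {1}(_ : x = x / 2 + x / 2); last by lra.
  rewrite cosD -!expr2 [cos _ ^+ 2]cos2sin2; ring.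
rewrite normrN normrM normrX (@ger0_norm _ 2)//.
have := norm_sin_le (x / 2); have := normr_ge0 (sin (x / 2)).
rewrite normrM (@ger0_norm _ 2^-1)// -[x ^+ 2]real_normK ?num_real//.
by have := normr_ge0 x; nra.
Qed.

Lemma norm_expR_addN_sub2_le (y : R) :
  `|expR y + expR (- y) - 2| <= y ^+ 2 * expR `|y|.
Proof.
have -> : expR y + expR (- y) - 2 = (expR (y / 2) - expR (- (y / 2))) ^+ 2.
  have e1 : expR y = expR (y / 2) ^+ 2 by rewrite -expRM_natl; congr expR; field.
  have e2 : expR (- y) = expR (- (y / 2)) ^+ 2.
    by rewrite -expRM_natl; congr expR; field.
  have e3 : expR (y / 2) * expR (- (y / 2)) = 1 by rewrite expRN divff// gt_eqF ?expR_gt0.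
  by rewrite e1 e2; move: e3; move: (expR (y / 2)) => p; move: (expR _) => q; nra.
rewrite normrX; have h := norm_expR_subN_le (y / 2).
have -> : y ^+ 2 * expR `|y| = (2 * `|y / 2| * expR `|y / 2|) ^+ 2.
  have h2 : 2 * `|y / 2| = `|y|.
    by rewrite normrM (@ger0_norm _ 2^-1)//; field.
  by rewrite exprMn -expRM_natl h2 real_normK ?num_real.
by rewrite lerXn2r ?nnegrE// !mulr_ge0// expR_ge0.
Qed.

(** The singular part of the integrand is the Cauchy kernel [C], taken twice, with integral 4 atan(T
    / a). What remains has numerator at most 3 a u^2 exp(|u|) (a^2 + t^2): the factor a^2 + t^2
    cancels the denominator, and 2 T is the length of the interval. *)
Lemma brw_sum_near0 T u a : 0 < T -> 0 < a -> a <= 1 ->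
  `|brw_sum T u a - 4 * atan (T / a)| <= 3 * a * u ^+ 2 * expR `|u| * (2 * T).
Proof.
move=> T0 a0 a1.
have N0 t : 0 < a ^+ 2 + t ^+ 2 by exact: sqr_add_gt0.
pose C t : R := a * (a ^+ 2 + t ^+ 2)^-1.
have cC : continuous C.
  move=> t; have N0t := lt0r_neq0 (N0 t).
  by apply/differentiable_continuous/derivable1_diffP; exact: ex_derive.
have c1 := @continuous_brw_re _ u _ a0; have c2 := @continuous_brw_re _ (- u) _ a0.
pose F := (brw_re u a \+ brw_re (- u) a \- (C \+ C))%R.
have cF : continuous F.
  move=> t; apply: cvgB; apply: cvgD => //.
  - exact: c1. - exact: c2. - exact: cC. - exact: cC.
have iI f : continuous f -> mu.-integrable `[- T, T] (EFin \o f).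
  exact: integrable_itv_continuous.
have -> : brw_sum T u a - 4 * atan (T / a) = \int[mu]_(t in `[- T, T]) F t.
  rewrite RintegralB ?RintegralD//.
  - rewrite /C Rintegral_cauchy_kernel ?ltW// /brw_sum /brw; ring.
  all: try exact: iI.
  - by apply: iI => t; apply: cvgD; [exact: c1|exact: c2].
  - by apply: iI => t; apply: cvgD; exact: cC.
apply: norm_Rintegral_itv_le => //; first exact: ltW.
move=> t; have Nt := N0 t.
(* The numerator is grouped into differences that are each of second order in u: cosh(a u) - 1,
   cos(t u) - 1, and sinh(a u) times sin(t u). *)
have -> : F t = (a * ((expR (a * u) + expR (- (a * u)) - 2) * cos (t * u)
    + 2 * (cos (t * u) - 1))
    + (expR (a * u) - expR (- (a * u))) * (t * sin (t * u))) / (a ^+ 2 + t ^+ 2).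
  by rewrite /F /C /brw_re /= !mulrN cosN sinN; field; rewrite lt0r_neq0.
rewrite normrM normfV (gtr0_norm Nt) ler_pdivrMr//.
pose M := expR `|u|.
have auM : expR `|a * u| <= M.
  by rewrite ler_expR normrM (gtr0_norm a0) ler_piMl.
have M1 : 1 <= M by rewrite -expR0 ler_expR.
have b1 : `|(expR (a * u) + expR (- (a * u)) - 2) * cos (t * u)| <=
    a ^+ 2 * u ^+ 2 * M.
  rewrite normrM -exprMn -[leRHS]mulr1 ler_pM ?cos_max//.
  by rewrite (le_trans (norm_expR_addN_sub2_le _))// ler_wpM2l// sqr_ge0.
have b2 : `|2 * (cos (t * u) - 1)| <= t ^+ 2 * u ^+ 2 * M.
  rewrite normrM ger0_norm// -exprMn.
  have := norm_cos_sub1_le (t * u); have := sqr_ge0 (t * u); nra.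
have b3 : `|(expR (a * u) - expR (- (a * u))) * (t * sin (t * u))| <=
    2 * a * u ^+ 2 * t ^+ 2 * M.
  have -> : 2 * a * u ^+ 2 * t ^+ 2 * M = (2 * `|a * u| * M) * (`|t| * `|t * u|).
    rewrite !normrM (gtr0_norm a0) -[u ^+ 2]real_normK ?num_real//.
    by rewrite -[t ^+ 2]real_normK ?num_real//; ring.
  rewrite normrM ler_pM//.
    by rewrite (le_trans (norm_expR_subN_le _))// ler_wpM2l// mulr_ge0.
  by rewrite normrM ler_wpM2l// norm_sin_le.
rewrite -/M (le_trans (ler_normD _ _))// normrM (gtr0_norm a0).
have := ler_normD ((expR (a * u) + expR (- (a * u)) - 2) * cos (t * u))
  (2 * (cos (t * u) - 1)).
have uM : 0 <= u ^+ 2 * M by rewrite mulr_ge0 ?sqr_ge0 ?expR_ge0.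
move: b1 b2 b3; set x1 := `|_ * cos _|; set x2 := `|_ * (_ - 1)|; set x3 := `|_ * _|.
set x4 := `|_|.
move=> b1 b2 b3 b4.
apply: (@le_trans _ _ (a * (a ^+ 2 * u ^+ 2 * M + t ^+ 2 * u ^+ 2 * M)
  + 2 * a * u ^+ 2 * t ^+ 2 * M)).
  by rewrite lerD// ler_wpM2l ?(ltW a0)//; lra.
have -> : 3 * a * u ^+ 2 * M * (a ^+ 2 + t ^+ 2) =
  (a * (a ^+ 2 * u ^+ 2 * M + t ^+ 2 * u ^+ 2 * M)
  + 2 * a * u ^+ 2 * t ^+ 2 * M) + 2 * a ^+ 3 * (u ^+ 2 * M) by ring.
by rewrite lerDl mulr_ge0// mulr_ge0// exprn_ge0// ltW.
Qed.
End bromwich_small_abscissa.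

(** * Uniform bound and limit of the truncated Bromwich integral *)

Section bromwich_limit.
Variable R : realType.
Implicit Types u s t c T : R.
Local Notation mu := (@lebesgue_measure R).

(** T is fixed and the abscissa a = T / x tends to 0: the error of [brw_sum_near0] becomes K / x,
    and 4 atan(x) tends to 2 pi, while the cost of moving from a to c stays bounded independently of
    a. *)
Lemma brw_sum_sub_2pi T u c : 0 < T -> 0 < c ->
  `|brw_sum T u c - 2 * pi| <= 8 * c * expR (c * `|u|) / T.
Proof.
move=> T0 c0; apply/ler_addgt0Pr => e e0.
pose K := 3 * T * u ^+ 2 * expR `|u| * (2 * T).
(* The error on atan is multiplied by 4 and so takes e / 2; the other half is left for K / x. *)
have e8 : 0 < e / 8 by rewrite divr_gt0.
near (pinfty_nbhs R) => x.
have x0 : 0 < x by near: x; apply: nbhs_pinfty_gt; rewrite num_real.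
have xT : T <= x by near: x; apply: nbhs_pinfty_ge; rewrite num_real.
have xTc : T / c <= x by near: x; apply: nbhs_pinfty_ge; rewrite num_real.
have xK : 2 * K / e <= x by near: x; apply: nbhs_pinfty_ge; rewrite num_real.
have ax : `|pi / 2 - atan x| < e / 8.
  by near: x; move/cvgrPdist_lt : (@cvgy_atan R); exact.
pose a := T / x.
have a0 : 0 < a by rewrite divr_gt0.
have a1 : a <= 1 by rewrite ler_pdivrMr// mul1r.
have ac : a <= c by rewrite ler_pdivrMr// -ler_pdivrMl// mulrC.
have := brw_sum_increment u T0 a0 ac.
have := brw_sum_near0 u T0 a0 a1.
have -> : T / a = x by rewrite /a; field; rewrite !lt0r_neq0.
have -> : 3 * a * u ^+ 2 * expR `|u| * (2 * T) = K / x.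
  by rewrite /K /a; field; rewrite lt0r_neq0.
have Kx : K / x <= e / 2.
  by rewrite ler_pdivrMr// -ler_pdivrMl ?divr_gt0// (le_trans _ xK).
move: (8 * c * expR _ / T) Kx ax => B Kx.
rewrite !ler_norml ltr_norml => /andP[p1 p2] /andP[q1 q2] /andP[r1 r2].
by apply/andP; split; lra.
Unshelve. all: by end_near. Qed.

(** Complements [brw_neg_le], which degenerates as T u tends to 0. The cosine term is bounded by the
    Cauchy kernel, of integral at most pi; in the sine term |t sin(t u)| <= t^2 |u| cancels the
    denominator. *)
Lemma norm_brw_le T u c : 0 < T -> 0 < c ->
  `|brw T u c| <= expR (c * u) * (pi + 2 * T * `|u|).
Proof.
move=> T0 c0; have TT : - T <= T by rewrite ge0_cp// ltW.
have N0 t : 0 < c ^+ 2 + t ^+ 2 by exact: sqr_add_gt0.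
pose C t : R := c * (c ^+ 2 + t ^+ 2)^-1.
have cC : continuous C.
  move=> t; have N0t := lt0r_neq0 (N0 t).
  by apply/differentiable_continuous/derivable1_diffP; exact: ex_derive.
have cb := @continuous_brw_re _ u _ c0.
have iI f : continuous f -> mu.-integrable `[- T, T] (EFin \o f).
  exact: integrable_itv_continuous.
pose E := expR (c * u).
have E0 : 0 <= E by exact: expR_ge0.
rewrite (le_trans (le_normr_Rintegral _ (iI _ cb)))//.
apply: (@le_trans _ _ (\int[mu]_(t in `[- T, T]) (E * C t + cst (E * `|u|) t))).
  apply: le_Rintegral => //.
  - by apply: iI => t; apply: cvg_norm; exact: cb.
  - apply: iI => t; apply: cvgD; last exact: cvg_cst.
    by apply: cvgM; [exact: cvg_cst|exact: cC].
  - move=> t _; rewrite /C /= -mulrDr /brw_re !normrM normfV.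
    rewrite (gtr0_norm (N0 t)) (ger0_norm (expR_ge0 _)) -mulrA ler_wpM2l//.
    rewrite ler_pdivrMr// mulrDl divfK ?lt0r_neq0//.
    rewrite (le_trans (ler_normD _ _))// lerD//.
      by rewrite normrM (gtr0_norm c0) ler_piMr ?cos_max// ltW.
    have := norm_sin_le (t * u); rewrite !normrM.
    rewrite -[t ^+ 2]real_normK ?num_real//.
    by have := normr_ge0 t; have := normr_ge0 u; have := sqr_ge0 c; nra.
rewrite RintegralD//; last 2 first.
- by apply: iI => t; apply: cvgM; [exact: cvg_cst|exact: cC].
- by apply: iI; exact: cst_continuous.
rewrite RintegralZl//; last exact: iI.
rewrite Rintegral_cauchy_kernel ?(ltW T0)// Rintegral_cst//.
rewrite /= lebesgue_measure_itv/= lte_fin ifT ?gtrN//= -mulrA -mulrDr ler_wpM2l//.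
have := atan_ltpi2 (T / c); rewrite opprK => h.
by rewrite lerD//; lra.
Qed.

Lemma pi_le4 : pi <= 4 :> R.
Proof. by have := pihalf_lt2 R; lra. Qed.

(** If T |u| <= 1, [norm_brw_le] gives pi + 2 <= 6; otherwise [brw_neg_le] gives a factor at most
    4. *)
Lemma norm_brw_npos_le T u c : 0 < T -> 0 < c -> u <= 0 ->
  `|brw T u c| <= 6 * expR (c * u).
Proof.
move=> T0 c0; rewrite mulrC; have E0 := expR_ge0 (c * u).
have [Tu|Tu] := leP (T * `|u|) 1 => u0.
  rewrite (le_trans (norm_brw_le _ T0 c0))// ler_wpM2l//.
  by have := pi_le4; rewrite -mulrA; lra.
have un : u < 0.
  rewrite lt_neqAle u0 andbT; apply/eqP => u00.
  by move: Tu; rewrite u00 normr0 mulr0 ltNge ler01.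
rewrite (le_trans (brw_neg_le T0 c0 un))// ler_wpM2l//.
move: Tu; rewrite (ltr0_norm un) mulrC => Tu.
by rewrite ler_pdivrMr ?(lt_trans ltr01)//; lra.
Qed.

(** Provides the dominating function for the limit in T. For u > 0 the integral is [brw_sum] minus
    the integral at - u, hence at most 8 c exp(c u) / T + 2 pi + 6; the 14 is 8 + 6, using pi <= 4,
    and T >= 1 removes the division. *)
Lemma brw_bounded c : 0 < c -> exists2 C : R, 0 <= C &
  forall T u, 1 <= T -> `|brw T u c| <= C * expR (c * u).
Proof.
move=> c0; exists (8 * c + 14); first by rewrite addr_ge0// mulr_ge0// ltW.
move=> T u T1; have T0 : 0 < T by exact: lt_le_trans T1.
have E0 := expR_ge0 (c * u).
have [u0|u0] := leP u 0.
  rewrite (le_trans (norm_brw_npos_le T0 c0 u0))// ler_wpM2r//.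
  by lra.
have cu0 : 0 <= c * u by rewrite mulr_ge0// ltW.
have E1 : 1 <= expR (c * u) by rewrite -expR0 ler_expR.
have E2 : expR (c * - u) <= 1 by rewrite -expR0 ler_expR mulrN oppr_le0.
have nu0 : - u <= 0 by rewrite oppr_le0 ltW.
have h1 := norm_brw_npos_le T0 c0 nu0.
have h2 := brw_sum_sub_2pi u T0 c0.
have h3 : 8 * c * expR (c * `|u|) / T <= 8 * c * expR (c * u).
  rewrite (gtr0_norm u0) ler_pdivrMr// ler_peMr// !mulr_ge0//; exact: ltW.
have h4 := pi_le4; have h5 := pi_ge0 R.
move: h1 h2; rewrite /brw_sum !ler_norml => /andP[p1 p2] /andP[q1 q2].
by rewrite mulrDl; apply/andP; split; lra.
Qed.

(* Heaviside function with value 1/2 at 0, as produced by the symmetric limit of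
   the Bromwich integral. *)
Definition half_step u : R := ((0 <= u)%R%:R + (0 < u)%R%:R) / 2.

Lemma cvg_divy (k : R) : k / T @[T --> +oo] --> (0 : R).
Proof.
rewrite -(mulr0 k); apply: cvgM; first exact: cvg_cst.
apply/(@gtr0_cvgV0 _ _ _ _ (fun T : R => T)); last exact: cvg_id.
by near=> T; near: T; apply: nbhs_pinfty_gt; rewrite num_real.
Unshelve. all: by end_near. Qed.

Lemma cvg_brw u c : 0 < c -> brw T u c @[T --> +oo] --> 2 * pi * half_step u.
Proof.
move=> c0.
have neg v : v < 0 -> brw T v c @[T --> +oo] --> (0 : R).
  move=> v0; apply/norm_cvg0P.
  apply: (@squeeze_cvgr _ _ _ _ (cst 0) (fun T => (expR (c * v) * (4 / - v)) / T)).
  - near=> T; rewrite normr_ge0/=.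
    have T0 : 0 < T by near: T; apply: nbhs_pinfty_gt; rewrite num_real.
    rewrite (le_trans (brw_neg_le T0 c0 v0))// le_eqVlt; apply/orP; left.
    by apply/eqP; field; rewrite lt0r_neq0//= ltr0_neq0.
  - exact: cvg_cst.
  - exact: cvg_divy.
have sum v : brw_sum T v c @[T --> +oo] --> 2 * pi.
  apply/subr_cvg0/norm_cvg0P.
  apply: (@squeeze_cvgr _ _ _ _ (cst 0) (fun T => (8 * c * expR (c * `|v|)) / T)).
  - near=> T; rewrite normr_ge0/=.
    have T0 : 0 < T by near: T; apply: nbhs_pinfty_gt; rewrite num_real.
    exact: brw_sum_sub_2pi.
  - exact: cvg_cst.
  - exact: cvg_divy.
rewrite /half_step; have [u0|u0|->] := ltgtP u 0.
- by rewrite addr0 mul0r mulr0; exact: neg.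
- rewrite (_ : (true%:R + true%:R) / 2 = 1 :> R) ?mulr1; last by rewrite /=; field.
  have -> : (fun T => brw T u c) = (fun T => brw_sum T u c - brw T (- u) c).
    by apply/funext => T; rewrite /brw_sum addrK.
  rewrite -[X in _ --> X]subr0; apply: cvgB; first exact: sum.
  by apply: neg; rewrite oppr_lt0.
(* At u = 0 the two terms of [brw_sum] coincide, which produces the value 1/2. *)
- have -> : (fun T => brw T 0 c) = (fun T => brw_sum T 0 c / 2).
    by apply/funext => T; rewrite /brw_sum oppr0; field.
  rewrite addr0 div1r; apply: cvgM; last exact: cvg_cst.
  exact: sum.
Unshelve. all: by end_near. Qed.
End bromwich_limit.

(** * Integrals of complex-valued functions *)

Section complex_modulus.
Variable R : realType.
Implicit Types z : R[i].

Lemma ReM z w : complex.Re (z * w) =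
  complex.Re z * complex.Re w - complex.Im z * complex.Im w.
Proof. by case: z => ? ?; case: w. Qed.

Lemma ImM z w : complex.Im (z * w) =
  complex.Re z * complex.Im w + complex.Im z * complex.Re w.
Proof. by case: z => ? ?; case: w. Qed.

Lemma normc_ge0 z : 0 <= Normc.normc z.
Proof. by case: z => a b; exact: sqrtr_ge0. Qed.

Lemma norm_Re_le z : `|complex.Re z| <= Normc.normc z.
Proof.
case: z => a b /=; rewrite -sqrtr_sqr ler_wsqrtr//.
by rewrite lerDl sqr_ge0.
Qed.

Lemma norm_Im_le z : `|complex.Im z| <= Normc.normc z.
Proof.
case: z => a b /=; rewrite -sqrtr_sqr ler_wsqrtr//.
by rewrite lerDr sqr_ge0.
Qed.

Lemma normc_le z : Normc.normc z <= `|complex.Re z| + `|complex.Im z|.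
Proof.
case: z => a b /=; rewrite -[leRHS]ger0_norm ?addr_ge0// -sqrtr_sqr.
rewrite ler_wsqrtr// sqrrD !real_normK ?num_real// -addrA lerD2l lerDr.
by rewrite mulrn_wge0// mulr_ge0.
Qed.

Lemma normc_real (x : R) : Normc.normc x%:C = `|x|.
Proof. by rewrite /= expr0n/= addr0 sqrtr_sqr. Qed.

Lemma normc_prod (I : Type) (s : seq I) (P : pred I) (F : I -> R[i]) :
  Normc.normc (\prod_(i <- s | P i) F i) = \prod_(i <- s | P i) Normc.normc (F i).
Proof.
by rewrite (big_morph (@Normc.normc R) (@Normc.normcM R) (@Normc.normc1 R)).
Qed.

Lemma normc_cexp z : Normc.normc (cexp z) = expR (complex.Re z).
Proof.
rewrite /cexp Normc.normcM normc_real /= cos2Dsin2 sqrtr1 mulr1 ger0_norm ?expR_ge0//.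
Qed.

Lemma cexpD z w : cexp (z + w) = cexp z * cexp w.
Proof.
case: z => a b; case: w => c d; rewrite /cexp /= expRD cosD sinD.
apply/eqP; rewrite eq_complex /=; apply/andP; split; apply/eqP; ring.
Qed.

Lemma cexp0 : cexp (0 : R[i]) = 1.
Proof.
rewrite /cexp /= expR0 cos0 sin0; apply/eqP; rewrite eq_complex /=.
by apply/andP; split; apply/eqP; ring.
Qed.

Lemma cexp_sum (I : Type) (s : seq I) (F : I -> R[i]) :
  cexp (\sum_(i <- s) F i) = \prod_(i <- s) cexp (F i).
Proof. by rewrite (big_morph (@cexp R) cexpD cexp0). Qed.

Lemma Re_sum (I : Type) (s : seq I) (F : I -> R[i]) :
  complex.Re (\sum_(i <- s) F i) = \sum_(i <- s) complex.Re (F i).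
Proof.
apply: (big_morph (fun z : R[i] => complex.Re z)) => //.
by case=> ? ?; case.
Qed.

Lemma Re_Mreal z (x : R) : complex.Re (z * x%:C) = complex.Re z * x.
Proof. by rewrite ReM /= mulr0 subr0. Qed.

Lemma normcV_le_ReV z : 0 < complex.Re z -> (Normc.normc z)^-1 <= (complex.Re z)^-1.
Proof.
move=> z0; have h : complex.Re z <= Normc.normc z.
  exact: le_trans (ler_norm _) (norm_Re_le z).
by rewrite lef_pV2 ?posrE// (lt_le_trans z0).
Qed.

End complex_modulus.

Section complex_measurable.
Variable R : realType.
Context d (T : measurableType d).

Definition cmeasurable (f : T -> R[i]) : Prop :=
  measurable_fun setT (fun x => complex.Re (f x)) /\
  measurable_fun setT (fun x => complex.Im (f x)).

Lemma cmeasurable_cst (a : R[i]) : cmeasurable (fun=> a).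
Proof. by split; exact: measurable_cst. Qed.

Lemma cmeasurable_real (f : T -> R) : measurable_fun setT f ->
  cmeasurable (fun x => (f x)%:C).
Proof. by move=> mf; split => //=; exact: measurable_cst. Qed.

Lemma cmeasurableM (f g : T -> R[i]) : cmeasurable f -> cmeasurable g ->
  cmeasurable (fun x => f x * g x).
Proof.
move=> [fr fi] [gr gi]; split.
  under eq_fun do rewrite ReM.
  by apply: measurable_funB; exact: measurable_funM.
under eq_fun do rewrite ImM.
by apply: measurable_funD; exact: measurable_funM.
Qed.

Lemma cmeasurable_prod (I : Type) (s : seq I) (F : I -> T -> R[i]) :
  (forall i, cmeasurable (F i)) -> cmeasurable (fun x => \prod_(i <- s) F i x).
Proof.
move=> mF; elim: s => [|i s IH].
  by under eq_fun do rewrite big_nil; exact: cmeasurable_cst.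
by under eq_fun do rewrite big_cons; exact: cmeasurableM.
Qed.

Lemma cmeasurable_cexp (f : T -> R[i]) : cmeasurable f ->
  cmeasurable (fun x => cexp (f x)).
Proof.
move=> [fr fi]; rewrite /cexp; apply: cmeasurableM.
  by apply: cmeasurable_real; exact: measurableT_comp.
split => /=.
  apply: (@measurableT_comp _ _ _ _ _ _ cos) => //.
  by apply: continuous_measurable_fun; exact: continuous_cos.
apply: (@measurableT_comp _ _ _ _ _ _ sin) => //.
by apply: continuous_measurable_fun; exact: continuous_sin.
Qed.

End complex_measurable.

Lemma cmeasurable_comp (R : realType) d1 d2 (T1 : measurableType d1)
    (T2 : measurableType d2) (phi : T1 -> T2) (f : T2 -> R[i]) :
  measurable_fun setT phi -> cmeasurable f -> cmeasurable (fun x => f (phi x)).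
Proof.
move=> mphi [fr fi].
split; [exact: (measurableT_comp fr mphi)|exact: (measurableT_comp fi mphi)].
Qed.

Section complex_integral.
Variable R : realType.
Context d (T : measurableType d) (mu : {measure set T -> \bar R}).
Implicit Types f g : T -> R[i].

Lemma cintegrable_measurable f : cintegrable mu setT f -> cmeasurable f.
Proof.
move=> [fr fi].
by split; apply/measurable_EFinP; [exact: (measurable_int mu fr)|exact: (measurable_int mu fi)].
Qed.

Lemma cintegrable_le f (h : T -> R) : cmeasurable f ->
  mu.-integrable setT (EFin \o h) -> (forall x, Normc.normc (f x) <= h x) ->
  cintegrable mu setT f.
Proof.
move=> [fr fi] ih fh; split; apply: (le_integrable _ _ _ ih) => //.
- exact/measurable_EFinP.
- move=> x _ /=; rewrite lee_fin (le_trans (norm_Re_le _))//.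
  by rewrite (le_trans (fh x))// ler_norm.
- exact/measurable_EFinP.
- move=> x _ /=; rewrite lee_fin (le_trans (norm_Im_le _))//.
  by rewrite (le_trans (fh x))// ler_norm.
Qed.

(** Converse to [cintegrable_le]. Together they reduce integrability of products and multiples to
    real majorants of the modulus. *)
Lemma cintegrable_dom f : cintegrable mu setT f ->
  exists2 h : T -> R, mu.-integrable setT (EFin \o h) &
    forall x, Normc.normc (f x) <= h x.
Proof.
move=> [fr fi].
exists (fun x => `|complex.Re (f x)| + `|complex.Im (f x)|).
  by apply: (@integrableD _ _ _ mu setT _ _ _ (integrable_norm fr) (integrable_norm fi)).
by move=> x; exact: normc_le.
Qed.

Lemma cintegrableZ (a : R[i]) f : cintegrable mu setT f ->
  cintegrable mu setT (fun x => a * f x).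
Proof.
move=> fi; have [h ih fh] := cintegrable_dom fi.
apply: (@cintegrable_le _ (fun x => Normc.normc a * h x)).
- apply: cmeasurableM; first exact: cmeasurable_cst.
  exact: cintegrable_measurable.
- exact: (integrableZl measurableT (Normc.normc a) ih).
- by move=> x; rewrite Normc.normcM ler_wpM2l ?normc_ge0.
Qed.

Lemma cintegralZ (a : R[i]) f : cintegrable mu setT f ->
  cintegral mu setT (fun x => a * f x) = a * cintegral mu setT f.
Proof.
move=> [fr fi]; apply/eqP; rewrite eq_complex !(ReM, ImM) /=.
have iZ k (u : T -> R) : mu.-integrable setT (EFin \o u) ->
    mu.-integrable setT (EFin \o (fun x => k * u x)).
  by move=> iu; exact: (integrableZl measurableT k iu).
apply/andP; split; apply/eqP.
  under eq_Rintegral do rewrite ReM.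
  by rewrite RintegralB ?RintegralZl//; exact: iZ.
under eq_Rintegral do rewrite ImM.
by rewrite RintegralD ?RintegralZl//; exact: iZ.
Qed.

Lemma eq_cintegral (D : set T) f g : (forall x, D x -> f x = g x) ->
  cintegral mu D f = cintegral mu D g.
Proof.
move=> fg; rewrite /cintegral; congr (_ +i* _);
  by apply: eq_Rintegral => x /set_mem Dx; rewrite fg.
Qed.

Lemma cintegral_mkcond (D : set T) f :
  cintegral mu D f = cintegral mu setT (fun x => (\1_D x : R)%:C * f x).
Proof.
rewrite /cintegral; congr (_ +i* _).
  rewrite Rintegral_mkcond; apply: eq_Rintegral => x _.
  by rewrite ReM /= mul0r subr0 patchE indicE; case: ifP; rewrite ?mul1r ?mul0r.
rewrite Rintegral_mkcond; apply: eq_Rintegral => x _.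
by rewrite ImM /= mul0r addr0 patchE indicE; case: ifP; rewrite ?mul1r ?mul0r.
Qed.

Lemma cintegrable_mkcond (D : set T) f : measurable D ->
  cintegrable mu setT (fun x => (\1_D x : R)%:C * f x) -> cintegrable mu D f.
Proof.
move=> mD [fr fi]; split; apply/(integrable_mkcond _ mD).
  rewrite restrict_EFin; apply: eq_integrable fr => // x _ /=.
  by rewrite ReM /= mul0r subr0 patchE indicE; case: ifP; rewrite ?mul1r ?mul0r.
rewrite restrict_EFin; apply: eq_integrable fi => // x _ /=.
by rewrite ImM /= mul0r addr0 patchE indicE; case: ifP; rewrite ?mul1r ?mul0r.
Qed.

End complex_integral.

(* All sections are assumed integrable, rather than almost all, so that the inner
   real-valued integrals, which are 0 for a non-integrable function, agree
   everywhere with the extended ones. *)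
Section fubini_everywhere.
Variable R : realType.
Context d1 d2 (T1 : measurableType d1) (T2 : measurableType d2).
Variables (m1 : {sigma_finite_measure set T1 -> \bar R})
  (m2 : {sigma_finite_measure set T2 -> \bar R}).

Lemma integrable_prod_mul (f : T1 -> R) (g : T2 -> R) :
  m1.-integrable setT (EFin \o f) -> m2.-integrable setT (EFin \o g) ->
  (m1 \x m2)%E.-integrable setT (EFin \o (fun z => f z.1 * g z.2)).
Proof.
move=> fi gi; apply/integrable12ltyP => /=.
  apply/measurable_EFinP; apply: measurable_funM.
    apply: measurableT_comp => //.
    by apply/measurable_EFinP; exact: (measurable_int m1 fi).
  apply: measurableT_comp => //.
  by apply/measurable_EFinP; exact: (measurable_int m2 gi).
under eq_integral => x _.
  under eq_integral do rewrite /= normrM EFinM.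
  rewrite ge0_integralZl//; last first.
    exact: (measurable_int m2 (integrable_norm gi)).
  over.
have gfin : (\int[m2]_y `|g y|%:E)%E \is a fin_num.
  exact: (integrable_fin_num measurableT (integrable_norm gi)).
have ffin : (\int[m1]_y `|f y|%:E)%E \is a fin_num.
  exact: (integrable_fin_num measurableT (integrable_norm fi)).
rewrite -(fineK gfin) ge0_integralZr//.
- by rewrite -(fineK ffin) ltry.
- exact: (measurable_int m1 (integrable_norm fi)).
- by rewrite lee_fin fine_ge0// integral_ge0.
Qed.

Lemma Rintegral_fubini1 (f : T1 * T2 -> R) :
  (m1 \x m2)%E.-integrable setT (EFin \o f) ->
  (forall x, m2.-integrable setT (EFin \o (fun y => f (x, y)))) ->
  m1.-integrable setT (EFin \o (fun x => \int[m2]_y f (x, y))) /\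
  \int[m1]_x \int[m2]_y f (x, y) = \int[(m1 \x m2)%E]_z f z.
Proof.
move=> fi f1.
have FE : EFin \o (fun x => \int[m2]_y f (x, y)) = fubini_F m2 (EFin \o f).
  by apply/funext => x /=; rewrite fineK//; exact: (integrable_fin_num measurableT (f1 x)).
split; first by rewrite FE; exact: integrable_fubini_F.
rewrite /Rintegral -(integral12_prod_meas1 fi).
by congr fine; apply: eq_integral => x _; rewrite -FE.
Qed.

Lemma Rintegral_fubini2 (f : T1 * T2 -> R) :
  (m1 \x m2)%E.-integrable setT (EFin \o f) ->
  (forall y, m1.-integrable setT (EFin \o (fun x => f (x, y)))) ->
  measurable_fun setT (fun y => \int[m1]_x f (x, y)) /\
  \int[m2]_y \int[m1]_x f (x, y) = \int[(m1 \x m2)%E]_z f z.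
Proof.
move=> fi f2.
have GE : EFin \o (fun y => \int[m1]_x f (x, y)) = fubini_G m1 (EFin \o f).
  by apply/funext => y /=; rewrite fineK//; exact: (integrable_fin_num measurableT (f2 y)).
split; first by apply/measurable_EFinP; rewrite GE; exact: (measurable_fubini_G fi).
rewrite /Rintegral -(integral21_prod_meas1 fi).
by congr fine; apply: eq_integral => x _; rewrite -GE.
Qed.

Lemma cintegral_fubini1 (f : T1 * T2 -> R[i]) :
  cintegrable (m1 \x m2)%E setT f ->
  (forall x, cintegrable m2 setT (fun y => f (x, y))) ->
  cintegrable m1 setT (fun x => cintegral m2 setT (fun y => f (x, y))) /\
  cintegral m1 setT (fun x => cintegral m2 setT (fun y => f (x, y))) =
    cintegral (m1 \x m2)%E setT f.
Proof.
move=> [fr fi] f1.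
have [ir er] := Rintegral_fubini1 fr (fun x => (f1 x).1).
have [ii ei] := Rintegral_fubini1 fi (fun x => (f1 x).2).
by split => //; rewrite /cintegral /= er ei.
Qed.

Lemma cintegral_fubini2 (f : T1 * T2 -> R[i]) :
  cintegrable (m1 \x m2)%E setT f ->
  (forall y, cintegrable m1 setT (fun x => f (x, y))) ->
  cmeasurable (fun y => cintegral m1 setT (fun x => f (x, y))) /\
  cintegral m2 setT (fun y => cintegral m1 setT (fun x => f (x, y))) =
    cintegral (m1 \x m2)%E setT f.
Proof.
move=> [fr fi] f2.
have [mr er] := Rintegral_fubini2 fr (fun y => (f2 y).1).
have [mi ei] := Rintegral_fubini2 fi (fun y => (f2 y).2).
by split => //; rewrite /cintegral /= er ei.
Qed.

Lemma cintegrable_prod_le (F : T1 * T2 -> R[i]) (f : T1 -> R) (g : T2 -> R) :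
  cmeasurable F ->
  m1.-integrable setT (EFin \o f) -> m2.-integrable setT (EFin \o g) ->
  (forall z, Normc.normc (F z) <= f z.1 * g z.2) ->
  cintegrable (m1 \x m2)%E setT F.
Proof. by move=> mF fi gi; apply: cintegrable_le => //; exact: integrable_prod_mul. Qed.

Lemma cintegral_prod_mul (f : T1 -> R[i]) (g : T2 -> R[i]) :
  cintegrable m1 setT f -> cintegrable m2 setT g ->
  cintegrable (m1 \x m2)%E setT (fun z => f z.1 * g z.2) /\
  cintegral (m1 \x m2)%E setT (fun z => f z.1 * g z.2) =
    cintegral m1 setT f * cintegral m2 setT g.
Proof.
move=> fi gi.
have [hf ihf fh] := cintegrable_dom fi; have [hg ihg gh] := cintegrable_dom gi.
have ifg : cintegrable (m1 \x m2)%E setT (fun z => f z.1 * g z.2).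
  apply: (@cintegrable_prod_le _ hf hg) => //.
    apply: cmeasurableM.
      apply: (cmeasurable_comp measurable_fst); exact: cintegrable_measurable fi.
    apply: (cmeasurable_comp measurable_snd); exact: cintegrable_measurable gi.
  by move=> z; rewrite Normc.normcM ler_pM ?normc_ge0.
split=> //.
have sec x : cintegrable m2 setT (fun y => f x * g y) by exact: cintegrableZ.
rewrite -(cintegral_fubini1 ifg sec).2 /=.
rewrite mulrC -cintegralZ//; apply: eq_cintegral => x _.
by rewrite cintegralZ// mulrC.
Qed.

End fubini_everywhere.

(** * Integrals of products over R^n *)

Section tuple_integrals.
Variable R : realType.
Local Notation mR := (measurableTypeR R).
Local Notation leb := (@lebesgue_measure R).

Definition consp n (p : mR * n.-tuple mR) : n.+1.-tuple mR := cons_tuple p.1 p.2.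

Lemma measurable_consp n : measurable_fun setT (@consp n).
Proof. exact: measurable_cons. Qed.

Lemma tuple_lebesgueS n (B : set (n.+1.-tuple mR)) :
  tuple_lebesgue n.+1 B =
  pushforward (leb \x tuple_lebesgue n)%E (@consp n) B.
Proof.
rewrite /pushforward /= /product_measure1; apply: eq_integral => x _ /=.
by congr (tuple_lebesgue n _); apply/funext => t /=; rewrite /xsection /= inE.
Qed.

Lemma Rintegral_tupleS n (f : n.+1.-tuple mR -> R) :
  (leb \x tuple_lebesgue n)%E.-integrable setT (EFin \o (f \o @consp n)) ->
  measurable_fun setT f ->
  (tuple_lebesgue n.+1).-integrable setT (EFin \o f) /\
  \int[tuple_lebesgue n.+1]_t f t =
    \int[(leb \x tuple_lebesgue n)%E]_z f (consp z).
Proof.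
move=> fi mf.
have mf' : measurable_fun setT (EFin \o f) by exact/measurable_EFinP.
split.
  have /integrableP[_ foo] := integrable_pushforward (@measurable_consp n) mf'
    fi measurableT.
  apply/integrableP; split => //; move: foo; congr (_ < _)%E.
  apply: eq_measure_integral; first exact: measurable_consp.
  by move=> ? B _ _; exact/esym/tuple_lebesgueS.
rewrite /Rintegral; congr fine.
rewrite -(integral_pushforward (@measurable_consp n) mf' fi measurableT).
apply: eq_measure_integral; first exact: measurable_consp.
by move=> ? B _ _; exact: tuple_lebesgueS.
Qed.

Lemma cintegral_tuple_prod n (f : 'I_n -> mR -> R[i]) :
  (forall i, cintegrable leb setT (f i)) ->
  cintegrable (tuple_lebesgue n) setT
    (fun t : n.-tuple mR => \prod_(i < n) f i (tnth t i)) /\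
  cintegral (tuple_lebesgue n) setT
    (fun t : n.-tuple mR => \prod_(i < n) f i (tnth t i)) =
    \prod_(i < n) cintegral leb setT (f i).
Proof.
elim: n f => [|n IH] f fi.
  have -> : (fun t : 0.-tuple mR => \prod_(i < 0) f i (tnth t i)) = fun=> 1.
    by apply/funext => t; rewrite big_ord0.
  (* In dimension 0 the measure is a unit mass, so the empty product has integral 1. *)
  have iE (a : R) : (\int[tuple_lebesgue 0]_x a%:E = a%:E :> \bar R)%E.
    transitivity (\int[\d_([tuple] : 0.-tuple mR)]_x a%:E)%E.
      exact: eq_measure_integral.
    by rewrite integral_dirac//= diracT mul1e.
  split; last first.
    by rewrite big_ord0 /cintegral /Rintegral !iE.
  by split; apply/integrableP; split => //=;
    [exact: measurable_cst|rewrite iE ltry|exact: measurable_cst|rewrite iE ltry].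
have [ih ihE] := IH (fun i => f (lift ord0 i)) (fun i => fi _).
have [pi pE] := cintegral_prod_mul (fi ord0) ih.
set g := fun t : n.+1.-tuple mR => _.
have gE z : g (consp z) = f ord0 z.1 * \prod_(i < n) f (lift ord0 i) (tnth z.2 i).
  rewrite /g big_ord_recl tnth0; congr (_ * _); apply: eq_bigr => i _.
  by rewrite tnthS.
have [mr mi] : cmeasurable g.
  apply: cmeasurable_prod => i.
  apply: (cmeasurable_comp (measurable_tnth i)).
  exact: cintegrable_measurable (fi i).
have [ir er] : (tuple_lebesgue n.+1).-integrable setT (EFin \o (fun t => complex.Re (g t))) /\
  \int[tuple_lebesgue n.+1]_t complex.Re (g t) =
    \int[(leb \x tuple_lebesgue n)%E]_z complex.Re (g (consp z)).
  apply: Rintegral_tupleS => //; case: pi => pr _.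
  by apply: eq_integrable pr => // z _ /=; rewrite gE.
have [ii ei] : (tuple_lebesgue n.+1).-integrable setT (EFin \o (fun t => complex.Im (g t))) /\
  \int[tuple_lebesgue n.+1]_t complex.Im (g t) =
    \int[(leb \x tuple_lebesgue n)%E]_z complex.Im (g (consp z)).
  apply: Rintegral_tupleS => //; case: pi => _ pi'.
  by apply: eq_integrable pi' => // z _ /=; rewrite gE.
split => //.
rewrite big_ord_recl -ihE -pE /cintegral er ei.
by congr (_ +i* _); apply: eq_Rintegral => z _; rewrite gE.
Qed.

End tuple_integrals.

(** * One-dimensional exponential integrals *)

Section exponential_integrals.
Variable R : realType.
Local Notation mR := (measurableTypeR R).
Local Notation leb := (@lebesgue_measure R).

Lemma cvg_expR_decay (a : R) : 0 < a -> expR (- (a * s)) @[s --> +oo] --> (0 : R).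
Proof.
move=> a0; apply: (@squeeze_cvgr _ _ _ _ (cst 0) (fun s => a^-1 / s)).
- near=> s; rewrite expR_ge0/=.
  have s0 : 0 < s by near: s; apply: nbhs_pinfty_gt; rewrite num_real.
  have as0 : 0 < a * s by rewrite mulr_gt0.
  rewrite expRN -invfM lef_pV2 ?posrE ?expR_gt0//.
  by rewrite (le_trans _ (expR_ge1Dx _))// lerDr.
- exact: cvg_cst.
- exact: cvg_divy.
Unshelve. all: by end_near. Qed.

Lemma Rintegral_decay (F f : R -> R) (a b K : R) : 0 < a ->
  continuous f -> (forall s : R, is_derive s (1 : R) F (f s)) ->
  (forall s, `|f s| <= expR (- (a * s))) ->
  (forall s, `|F s| <= K * expR (- (a * s))) ->
  leb.-integrable `[b, +oo[ (EFin \o f) /\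
  \int[leb]_(s in `[b, +oo[) f s = - F b.
Proof.
move=> a0 cf dF fe FK.
pose e (s : R) := expR (- (a * s)).
pose E (s : R) := - (a^-1 * e s).
have dE (s : R) : is_derive s (1 : R) E (e s).
  rewrite /E /e; apply: is_derive_eq; rewrite /GRing.scale/=; field.
  by rewrite lt0r_neq0.
have cts (G g : R -> R) : (forall s : R, is_derive s (1 : R) G (g s)) -> continuous G.
  by move=> dG s; apply/differentiable_continuous/derivable1_diffP; case: (dG s).
have ce : continuous e.
  move=> s; rewrite /e; apply/differentiable_continuous/derivable1_diffP.
  exact: ex_derive.
have E0 : E s @[s --> +oo] --> (0 : R).
  rewrite /E -oppr0 -(mulr0 a^-1); apply: cvgN; apply: cvgM; first exact: cvg_cst.
  exact: cvg_expR_decay.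
have F0 : F s @[s --> +oo] --> (0 : R).
  apply/norm_cvg0P.
  apply: (@squeeze_cvgr _ _ _ _ (cst 0) (fun s => K * e s)).
  - by near=> s; rewrite normr_ge0/= FK.
  - exact: cvg_cst.
  - rewrite -(mulr0 K); apply: cvgM; first exact: cvg_cst.
    exact: cvg_expR_decay.
have pos (G g : R -> R) : continuous g -> (forall s : R, is_derive s (1 : R) G (g s)) ->
    (forall s, 0 <= g s) -> G s @[s --> +oo] --> (0 : R) ->
    leb.-integrable `[b, +oo[ (EFin \o g) /\
    \int[leb]_(s in `[b, +oo[) g s = - G b.
  move=> cg dG g0 G0.
  have gE : (\int[leb]_(s in `[b, +oo[) (g s)%:E = 0%:E - (G b)%:E)%E.
    apply: ge0_continuous_FTC2y => //.
    - by apply: continuous_subspaceT => s; exact: cg.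
    - by apply: cvg_at_right_filter; exact: (cts _ _ dG).
    - by move=> s _; rewrite derive1E; exact: (@derive_val _ _ _ _ _ _ _ (dG s)).
  split; last by rewrite /Rintegral gE /= sub0r.
  apply/integrableP; split.
    apply/measurable_EFinP; apply: measurable_funTS.
    exact: continuous_measurable_fun.
  under eq_integral do rewrite /= ger0_norm//.
  by rewrite gE ltry.
(* [f + e] is nonnegative, so the improper FTC of the library applies to it *)
have [ie eE] := pos E e ce dE (fun s => expR_ge0 _) E0.
have cfe : continuous (f \+ e) by move=> s; apply: cvgD; [exact: cf|exact: ce].
have dFE (s : R) : is_derive s (1 : R) (F \+ E) ((f \+ e) s).
  exact: is_deriveD (dF s) (dE s).
have fe0 s : 0 <= (f \+ e) s.
  by have := fe s; rewrite ler_norml => /andP[h _] /=; rewrite -lerBlDr sub0r.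
have FE0 : (F \+ E) s @[s --> +oo] --> (0 : R).
  by rewrite -(addr0 0); apply: cvgD.
have [ife feE] := pos (F \+ E) (f \+ e) cfe dFE fe0 FE0.
have fE : f = ((f \+ e) \- e) by apply/funext => s /=; rewrite addrK.
split.
  rewrite fE; apply: eq_integrable (integrableB _ ife ie) => //.
rewrite {1}fE RintegralB// feE eE /=; ring.
Unshelve. all: by end_near. Qed.

(** The one-dimensional factor of both integrations: in y it occurs with l = lambda_i and b =
    (Ax)_i, in x with l = (A'lambda)_j and b = 0. *)
Definition exp_step (l : R[i]) (b s : R) : R[i] :=
  cexp (- (l * s%:C)) * ((b <= s)%R%:R)%:C.

Lemma cintegral_exp_step (l : R[i]) (b : R) : 0 < complex.Re l ->
  cintegrable leb setT (exp_step l b) /\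
  cintegral leb setT (exp_step l b) = cexp (- (l * b%:C)) / l.
Proof.
case: l => a w /= a0.
have N0 := sqr_add_gt0 w a0; have N0' := lt0r_neq0 N0.
pose e (s : R) := expR (- (a * s)).
pose fr (s : R) := e s * cos (w * s).
pose fi (s : R) := e s * - sin (w * s).
(* [Fr] and [Fi] are the real and imaginary parts of the primitive - exp(- l s) / l, written in the
   shape to which [norm_lin_div_sqr_le] applies. *)
pose Fr (s : R) := e s * (a * - cos (w * s) + w * sin (w * s)) * (a ^+ 2 + w ^+ 2)^-1.
pose Fi (s : R) := e s * (a * sin (w * s) + w * cos (w * s)) * (a ^+ 2 + w ^+ 2)^-1.
have dFr (s : R) : is_derive s (1 : R) Fr (fr s).
  rewrite /Fr /fr /e; apply: is_derive_eq; rewrite /GRing.scale/=; field.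
  done.
have dFi (s : R) : is_derive s (1 : R) Fi (fi s).
  rewrite /Fi /fi /e; apply: is_derive_eq; rewrite /GRing.scale/=; field.
  done.
have cfr : continuous fr.
  move=> s; rewrite /fr /e; apply/differentiable_continuous/derivable1_diffP.
  exact: ex_derive.
have cfi : continuous fi.
  move=> s; rewrite /fi /e; apply/differentiable_continuous/derivable1_diffP.
  exact: ex_derive.
have e0 s : 0 <= e s by exact: expR_ge0.
have frle s : `|fr s| <= e s.
  by rewrite normrM ger0_norm// ler_piMr// cos_max.
have file s : `|fi s| <= e s.
  by rewrite normrM normrN ger0_norm// ler_piMr// sin_max.
have Fle (x y s : R) : `|x| <= 1 -> `|y| <= 1 ->
    `|e s * (a * x + w * y) * (a ^+ 2 + w ^+ 2)^-1| <= 2 / a * e s.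
  move=> x1 y1; rewrite !normrM normfV (gtr0_norm N0) (ger0_norm (e0 s)) -mulrA mulrC.
  by rewrite ler_wpM2r// norm_lin_div_sqr_le.
have Frle s : `|Fr s| <= 2 / a * e s.
  by rewrite /Fr Fle ?normrN ?cos_max ?sin_max.
have File s : `|Fi s| <= 2 / a * e s by rewrite /Fi Fle ?cos_max ?sin_max.
have [ir er] := Rintegral_decay b a0 cfr dFr frle Frle.
have [ii ei] := Rintegral_decay b a0 cfi dFi file File.
have sE s : exp_step (a +i* w) b s =
    (fr s * ((b <= s)%R%:R)) +i* (fi s * ((b <= s)%R%:R)).
  rewrite /exp_step /cexp /fr /fi /e /=; apply/eqP; rewrite eq_complex /=.
  by rewrite !(mulr0, mul0r, addr0, subr0, add0r) cosN sinN !eqxx.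
have pE (f : R -> R) : (fun s => f s * ((b <= s)%R%:R)) = f \_ `[b, +oo[.
  apply/funext => s; rewrite patchE mem_setE /= in_itv /= andbT.
  by case: ifP => _; rewrite ?mulr1 ?mulr0.
have rE : (fun s => complex.Re (exp_step (a +i* w) b s)) = fr \_ `[b, +oo[.
  by rewrite -pE; apply/funext => s; rewrite sE.
have iE : (fun s => complex.Im (exp_step (a +i* w) b s)) = fi \_ `[b, +oo[.
  by rewrite -pE; apply/funext => s; rewrite sE.
split.
  split.
    by rewrite rE -restrict_EFin -integrable_mkcond.
  by rewrite iE -restrict_EFin -integrable_mkcond.
rewrite /cintegral rE iE -!Rintegral_mkcond er ei.
rewrite /Fr /Fi /e /cexp; apply/eqP; rewrite eq_complex /=.
by rewrite !(mulr0, mul0r, addr0, subr0, add0r) cosN sinN; apply/andP; split; apply/eqP; field.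
Qed.

End exponential_integrals.

(** * Inversion along vertical lines *)

Lemma measurable_natr_bool (R : realType) d (T : measurableType d) (f : T -> bool) :
  measurable_fun setT f -> measurable_fun setT (fun x => (f x)%:R : R).
Proof.
move=> mf; have -> : (fun x => (f x)%:R) = (\1_[set x | f x] : T -> R).
  by apply/funext => x; rewrite indicE mem_setE.
apply: measurable_indic.
by have := mf measurableT [set true] I; rewrite setTI.
Qed.

Section bromwich_inversion.
Variable R : realType.
Local Notation leb := (@lebesgue_measure R).

Lemma measurable_half_step : measurable_fun setT (@half_step R).
Proof.
rewrite /half_step; apply: measurable_funM => //.
apply: measurable_funD; apply: measurable_natr_bool.
  exact: measurable_fun_ler.
exact: measurable_fun_ltr.
Qed.

Lemma Rintegral_odd (f : R -> R) (T : R) : 0 <= T -> continuous f ->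
  (forall t, f (- t) = - f t) -> \int[leb]_(t in `[- T, T]) f t = 0.
Proof.
move=> T0 cf of_; have TT : - T <= T by rewrite ge0_cp.
have fi := @integrable_itv_continuous R f (- T) T cf.
have : \int[leb]_(t in `[- T, T]) f t = - \int[leb]_(t in `[- T, T]) f t.
  rewrite {1}/Rintegral -{2}(opprK T).
  rewrite integration_by_substitution_oppr//; last first.
    by rewrite opprK; apply: continuous_subspaceT => t; exact: cf.
  rewrite -[RHS]mulN1r -RintegralZl//; congr fine.
  by apply: eq_integral => t _ /=; rewrite of_ mulN1r.
by lra.
Qed.

Definition laplace_kernel (c u t : R) : R[i] :=
  cexp ((c +i* t) * u%:C) / (c +i* t).

Lemma laplace_kernelE (c u t : R) : 0 < c ->
  laplace_kernel c u t = brw_re u c t +i* brw_im u c t.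
Proof.
move=> c0; have N0 := lt0r_neq0 (sqr_add_gt0 t c0).
rewrite /laplace_kernel /cexp /brw_re /brw_im /=.
apply/eqP; rewrite eq_complex /= !(mulr0, subr0, mul0r, add0r, addr0).
by apply/andP; split; apply/eqP; field.
Qed.

(** The imaginary part is odd in t, so the symmetric truncation cancels it. *)
Lemma cintegral_laplace_kernel (c u T : R) : 0 < c -> 0 < T ->
  cintegral leb `[- T, T] (laplace_kernel c u) = (brw T u c)%:C.
Proof.
move=> c0 T0.
transitivity (cintegral leb `[- T, T] (fun t => brw_re u c t +i* brw_im u c t)).
  by apply: eq_cintegral => t _; exact: laplace_kernelE.
rewrite /cintegral /= (@Rintegral_odd (brw_im u c)) ?(ltW T0)//.
  move=> t; apply/differentiable_continuous/derivable1_diffP.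
  by case: (is_derive_brw_im u t c0).
by move=> t; rewrite /brw_im sqrrN !mulNr cosN sinN; ring.
Qed.

Lemma normc_laplace_kernel_le (c u t : R) : 0 < c ->
  Normc.normc (laplace_kernel c u t) <= expR (c * u) / c.
Proof.
move=> c0; rewrite /laplace_kernel Normc.normcM Normc.normcV normc_cexp Re_Mreal.
by rewrite ler_wpM2l ?expR_ge0//; exact: (@normcV_le_ReV _ (c +i* t)).
Qed.

Lemma cmeasurable_vline (c : R) : cmeasurable (fun t : measurableTypeR R => c +i* t).
Proof. by split => //=; exact: measurable_cst. Qed.

Lemma cmeasurable_vline_inv (c : R) : 0 < c ->
  cmeasurable (fun t : measurableTypeR R => (c +i* t)^-1).
Proof.
move=> c0.
split => /=; apply: continuous_measurable_fun => t;
  have N0 := lt0r_neq0 (sqr_add_gt0 t c0);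
  apply/differentiable_continuous/derivable1_diffP; exact: ex_derive.
Qed.

Context d (X : measurableType d) (mu : {sigma_finite_measure set X -> \bar R}).

Lemma cvg_integral_brw (p b g : X -> R) (c : R) : 0 < c ->
  measurable_fun setT p -> measurable_fun setT b ->
  (forall T, 0 < T -> measurable_fun setT (fun x => p x * brw T (b x) c)) ->
  mu.-integrable setT (EFin \o g) ->
  (forall x, `|p x| * expR (c * b x) <= g x) ->
  \int[mu]_x (p x * brw T (b x) c) @[T --> +oo] -->
  \int[mu]_x (p x * (2 * pi * half_step (b x))).
Proof.
move=> c0 mp mb mpb ig pg.
have [C C0 CE] := brw_bounded c0.
(* The bound holds only for T >= 1, while dominated convergence needs it at every term of a sequence
   tending to +oo; clipping T at 1 leaves the limit unchanged. *)
pose m (T : R) := Num.max T 1.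
have m1 T : 1 <= m T by rewrite /m le_max lexx orbT.
have mE : \forall T \near +oo, m T = T.
  near=> T; rewrite /m max_l//; near: T; apply: nbhs_pinfty_ge; rewrite num_real.
suff : \int[mu]_x (p x * brw (m T) (b x) c) @[T --> +oo] -->
    \int[mu]_x (p x * (2 * pi * half_step (b x))).
  apply: cvg_trans; apply: near_eq_cvg.
  by apply: filterS mE => T ->.
apply/cvg_pinftyP => u uoo.
have ptw x : p x * brw (m (u n)) (b x) c @[n --> \oo] -->
    p x * (2 * pi * half_step (b x)).
  apply: cvgM; first exact: cvg_cst.
  have : brw (m T) (b x) c @[T --> +oo] --> 2 * pi * half_step (b x).
    apply: cvg_trans; last exact: (@cvg_brw _ (b x) _ c0).
    by apply: near_eq_cvg; apply: filterS mE => T ->.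
  by move/cvg_pinftyP; exact.
have mlim : measurable_fun setT (fun x => p x * (2 * pi * half_step (b x))).
  apply: measurable_funM => //; apply: measurable_funM => //.
  exact: (measurableT_comp measurable_half_step mb).
have dom x n : `|p x * brw (m (u n)) (b x) c| <= C * g x.
  rewrite normrM (le_trans (ler_wpM2l _ (CE _ _ (m1 _))))// mulrCA.
  by rewrite ler_wpM2l.
have [] := @dominated_convergence _ X R mu setT measurableT
  (fun n x => (p x * brw (m (u n)) (b x) c)%:E)
  (fun x => (p x * (2 * pi * half_step (b x)))%:E)
  (fun x => (C * g x)%:E).
- by move=> n; apply/measurable_EFinP/mpb; exact: lt_le_trans (m1 _).
- exact/measurable_EFinP.
- by apply: aeW => x _; apply/cvg_EFin; [exact: nearW|exact: ptw].
- exact: (integrableZl measurableT C ig).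
- by apply: aeW => x n _; rewrite lee_fin dom.
move=> il _ cv; apply: fine_cvg; rewrite /Rintegral fineK//.
exact: (integrable_fin_num measurableT il).
Unshelve. all: by end_near. Qed.

End bromwich_inversion.

(** * One vertical line integral under the integral sign *)

Section bromwich_step.
Variable R : realType.
Local Notation leb := (@lebesgue_measure R).
Context d (X : measurableType d) (mu : {sigma_finite_measure set X -> \bar R}).

Lemma integrable_indic_itv (a b : R) :
  leb.-integrable setT (EFin \o (\1_(`[a, b]%classic) : R -> R)).
Proof.
have := @integrable_itv_continuous R (cst 1) a b (@cst_continuous _ _ _).
rewrite integrable_mkcond// restrict_EFin.
apply: eq_integrable => // t _ /=.
by rewrite patchE indicE; case: ifP.
Qed.

Lemma half_step_ge0 (u : R) : 0 <= half_step u.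
Proof. by rewrite /half_step divr_ge0 ?addr_ge0 ?ler0n. Qed.

Lemma half_step_le (u : R) : half_step u <= (0 <= u)%R%:R.
Proof.
rewrite /half_step ler_pdivrMr// mulr_natr mulr2n lerD2l ler_nat.
by case: (ltP 0 u) => [/ltW ->|].
Qed.

Lemma half_step_ge (u : R) : (0 < u)%R%:R <= half_step u.
Proof.
rewrite /half_step ler_pdivlMr// mulr_natr mulr2n lerD2r ler_nat.
by case: (ltP 0 u) => [/ltW ->|].
Qed.

(** Exponential majorant of a step, as in Chernoff's bound: it lets indicators of constraints be
    dominated by integrable exponentials. *)
Lemma step_le_expR (c u : R) : 0 < c -> (0 <= u)%R%:R <= expR (c * u) :> R.
Proof.
move=> c0; case: (leP 0 u) => [u0|_]; last exact: expR_ge0.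
by rewrite -expR0 ler_expR mulr_ge0// ltW.
Qed.

Lemma half_step_le_expR (c u : R) : 0 < c -> half_step u <= expR (c * u).
Proof. by move=> c0; rewrite (le_trans (half_step_le u))// step_le_expR. Qed.

(** On [-T, T] times X the integrand is absolutely integrable, since |exp(z u) / z| <= exp(c u) / c
    on the line; Fubini then turns the t-integral into [brw T (b x) c], and T tends to +oo by
    dominated convergence. The weight [w] is complex because it will carry the factors of other
    variables lambda_k. *)
Lemma is_vline_integral_laplace (w : X -> R[i]) (b g : X -> R) (c : R) : 0 < c ->
  cmeasurable w -> measurable_fun setT b ->
  mu.-integrable setT (EFin \o g) ->
  (forall x, Normc.normc (w x) * expR (c * b x) <= g x) ->
  is_vline_integral c
    (fun z => cintegral mu setT (fun x => w x * (cexp (z * (b x)%:C) / z)))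
    (2 * pi%:C * 'i%C * cintegral mu setT (fun x => w x * (half_step (b x))%:C)).
Proof.
move=> c0 mw mb ig wg.
have g0 x : 0 <= g x.
  by rewrite (le_trans _ (wg x))// mulr_ge0 ?expR_ge0 ?normc_ge0.
pose k (t : R) (x : X) : R[i] := w x * laplace_kernel c (b x) t.
have kg t x : Normc.normc (k t x) <= c^-1 * g x.
  rewrite Normc.normcM.
  rewrite (le_trans (ler_wpM2l (normc_ge0 _) (normc_laplace_kernel_le _ _ c0)))//.
  by rewrite mulrA [leRHS]mulrC ler_wpM2r// invr_ge0 ltW.
pose ind (T t : R) : R := \1_(`[- T, T]%classic) t.
have ind01 T t : 0 <= ind T t <= 1.
  by rewrite /ind indicE; case: (_ \in _); rewrite /= ?lexx ?ler01.
have mind T : measurable_fun setT (ind T) by exact: measurable_indic.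
pose Phi T (z : measurableTypeR R * X) : R[i] := (ind T z.1)%:C * k z.1 z.2.
have mker : cmeasurable (fun z : measurableTypeR R * X => k z.1 z.2).
  apply: cmeasurableM.
    exact: (cmeasurable_comp measurable_snd mw).
  apply: cmeasurableM.
    apply: cmeasurable_cexp; apply: cmeasurableM.
      exact: (cmeasurable_comp measurable_fst (cmeasurable_vline c)).
    apply: cmeasurable_real.
    exact: (measurableT_comp mb measurable_snd).
  exact: (cmeasurable_comp measurable_fst (cmeasurable_vline_inv c0)).
have mPhi T : cmeasurable (Phi T).
  apply: cmeasurableM => //; apply: cmeasurable_real.
  exact: (measurableT_comp (mind T) measurable_fst).
have Phile T z : Normc.normc (Phi T z) <= ind T z.1 * (c^-1 * g z.2).
  rewrite Normc.normcM normc_real ger0_norm; last by case/andP: (ind01 T z.1).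
  by rewrite ler_wpM2l//; case/andP: (ind01 T z.1).
have icg : mu.-integrable setT (EFin \o (fun x => c^-1 * g x)).
  exact: (integrableZl measurableT c^-1 ig).
have iPhi T : cintegrable (leb \x mu)%E setT (Phi T).
  apply: (cintegrable_prod_le (mPhi T) _ icg (Phile T)).
  exact: integrable_indic_itv.
have ik t : cintegrable mu setT (k t).
  apply: (cintegrable_le _ icg (kg t)).
  exact: (cmeasurable_comp (pair1_measurable t) mker).
have iPhi1 T t : cintegrable mu setT (fun x => Phi T (t, x)).
  rewrite (_ : (fun x => Phi T (t, x)) = (fun x => (ind T t)%:C * k t x))//.
  exact: cintegrableZ.
have iPhi2 T x : cintegrable leb setT (fun t => Phi T (t, x)).
  apply: (@cintegrable_le R _ _ leb (fun t => Phi T (t, x))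
    (fun t => c^-1 * g x * ind T t)).
  - exact: (cmeasurable_comp (pair2_measurable x) (mPhi T)).
  - exact: (integrableZl measurableT (c^-1 * g x) (integrable_indic_itv _ _)).
  - by move=> t; rewrite mulrC; exact: (Phile T (t, x)).
have iF T := cintegral_fubini1 (iPhi T) (iPhi1 T).
have iG T := cintegral_fubini2 (iPhi T) (iPhi2 T).
pose F (z : R[i]) : R[i] := cintegral mu setT (fun x => w x * (cexp (z * (b x)%:C) / z)).
have FE T t : cintegral mu setT (fun x => Phi T (t, x)) = (ind T t)%:C * F (c +i* t).
  rewrite (_ : (fun x => Phi T (t, x)) = (fun x => (ind T t)%:C * k t x))//.
  exact: cintegralZ.
have hE T t : (\1_(`[- T, T]%classic) t : R)%:C * ('i%C * F (c +i* t)) =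
    'i%C * cintegral mu setT (fun x => Phi T (t, x)).
  by rewrite FE mulrCA.
have GE T x : 0 < T -> cintegral leb setT (fun t => Phi T (t, x)) =
    w x * (brw T (b x) c)%:C.
  move=> T0.
  have ikx : cintegrable leb setT (fun t => (ind T t)%:C * laplace_kernel c (b x) t).
    apply: (@cintegrable_le R _ _ leb _ (fun t => expR (c * b x) / c * ind T t)).
    - apply: cmeasurableM; first exact: cmeasurable_real (mind T).
      apply: cmeasurableM; last exact: cmeasurable_vline_inv.
      apply: cmeasurable_cexp; apply: cmeasurableM; first exact: cmeasurable_vline.
      exact: cmeasurable_cst.
    - exact: (integrableZl measurableT (expR (c * b x) / c) (integrable_indic_itv _ _)).
    - move=> t; case/andP: (ind01 T t) => i0 _.
      rewrite Normc.normcM normc_real ger0_norm// mulrC ler_wpM2r//.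
      exact: normc_laplace_kernel_le.
  transitivity (w x * cintegral leb setT
      (fun t => (ind T t)%:C * laplace_kernel c (b x) t)).
    rewrite -(cintegralZ _ ikx).
    by apply: eq_cintegral => t _; rewrite /Phi /k /= mulrCA.
  by rewrite -cintegral_laplace_kernel// [in RHS]cintegral_mkcond.
(* Measurability in x is read off from Fubini, rather than from regularity of [brw] in u. *)
have mwb T : 0 < T -> cmeasurable (fun x => w x * (brw T (b x) c)%:C).
  move=> T0; have [mG _] := iG T.
  by apply: eq_ind (mG) _ _; apply/funext => x; exact: GE.
have IE T : 0 < T -> cintegral leb `[- T, T] (fun t => 'i%C * F (c +i* t)) =
    'i%C * cintegral mu setT (fun x => w x * (brw T (b x) c)%:C).
  move=> T0; rewrite cintegral_mkcond.
  transitivity (cintegral leb setT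
      (fun t => 'i%C * cintegral mu setT (fun x => Phi T (t, x)))).
    by apply: eq_cintegral => t _; exact: hE.
  have [iF1 eF] := iF T; have [_ eG] := iG T.
  transitivity ('i%C * cintegral leb setT
      (fun t => cintegral mu setT (fun x => Phi T (t, x)))).
    exact: (cintegralZ 'i%C iF1).
  congr (_ * _).
  transitivity (cintegral (leb \x mu)%E setT (Phi T)); first exact: eF.
  transitivity (cintegral mu setT (fun x => cintegral leb setT (fun t => Phi T (t, x)))).
    exact: esym eG.
  by apply: eq_cintegral => x _; exact: GE.
have wRe x : `|complex.Re (w x)| * expR (c * b x) <= g x.
  by rewrite (le_trans _ (wg x))// ler_wpM2r ?expR_ge0// norm_Re_le.
have wIm x : `|complex.Im (w x)| * expR (c * b x) <= g x.
  by rewrite (le_trans _ (wg x))// ler_wpM2r ?expR_ge0// norm_Im_le.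
have [mwr mwi] := mw.
have ImMr (z : R[i]) (r : R) : complex.Im (z * r%:C) = complex.Im z * r.
  by rewrite ImM /= mulr0 add0r.
have cvRe : \int[mu]_x (complex.Re (w x) * brw T (b x) c) @[T --> +oo] -->
    \int[mu]_x (complex.Re (w x) * (2 * pi * half_step (b x))).
  apply: (cvg_integral_brw c0 mwr mb _ ig wRe) => T T0.
  by have [mR _] := mwb T T0; under eq_fun do rewrite -Re_Mreal.
have cvIm : \int[mu]_x (complex.Im (w x) * brw T (b x) c) @[T --> +oo] -->
    \int[mu]_x (complex.Im (w x) * (2 * pi * half_step (b x))).
  apply: (cvg_integral_brw c0 mwi mb _ ig wIm) => T T0.
  by have [_ mI] := mwb T T0; under eq_fun do rewrite -ImMr.
have iH : cintegrable mu setT (fun x => w x * (half_step (b x))%:C).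
  apply: (cintegrable_le _ ig).
    apply: cmeasurableM => //; apply: cmeasurable_real.
    exact: (measurableT_comp (@measurable_half_step R) mb).
  move=> x; rewrite Normc.normcM normc_real ger0_norm ?half_step_ge0//.
  by rewrite (le_trans _ (wg x))// ler_wpM2l ?normc_ge0// half_step_le_expR.
have vE : 2 * pi%:C * 'i%C * cintegral mu setT (fun x => w x * (half_step (b x))%:C)
  = 'i%C * cintegral mu setT (fun x => w x * (2 * pi * half_step (b x))%:C).
  rewrite mulrAC [RHS]mulrC; congr (_ * _); rewrite -cintegralZ//.
  apply: eq_cintegral => x _; rewrite !rmorphM /= rmorph_nat; ring.
split.
- move=> T; apply: cintegrable_mkcond => //.
  have [iF1 _] := iF T.
  rewrite (_ : (fun x => _) = (fun t => 'i%C * cintegral mu setT (fun x => Phi T (t, x)))).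
    exact: (cintegrableZ 'i%C iF1).
  by apply/funext => t; exact: hE.
(* The factor i of dz = i dt exchanges the components: the real part converges by [cvIm], up to
   sign, and the imaginary part by [cvRe]. *)
- rewrite vE (_ : complex.Re _ =
    - \int[mu]_x (complex.Im (w x) * (2 * pi * half_step (b x)))); last first.
    rewrite ReM /= mul0r mul1r sub0r; congr (- _).
    by apply: eq_Rintegral => x _; exact: ImMr.
  apply: cvg_trans; last exact: (cvgN cvIm).
  apply: near_eq_cvg; near=> T.
  have T0 : 0 < T by near: T; apply: nbhs_pinfty_gt; rewrite num_real.
  rewrite [in RHS]IE// ReM /= mul0r mul1r sub0r; congr (- _).
  by apply: eq_Rintegral => x _; rewrite ImMr.
- rewrite vE (_ : complex.Im _ =
    \int[mu]_x (complex.Re (w x) * (2 * pi * half_step (b x)))); last first.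
    rewrite ImM /= mul0r mul1r add0r.
    by apply: eq_Rintegral => x _; exact: Re_Mreal.
  apply: cvg_trans; last exact: cvRe.
  apply: near_eq_cvg; near=> T.
  have T0 : 0 < T by near: T; apply: nbhs_pinfty_gt; rewrite num_real.
  rewrite [in RHS]IE// ImM /= mul0r mul1r add0r.
  by apply: eq_Rintegral => x _; rewrite Re_Mreal.
Unshelve. all: by end_near. Qed.

End bromwich_step.

(** * Induction on the number of vertical lines *)

Section iterated_bromwich.
Variable R : realType.
Context d (X : measurableType d) (mu : {sigma_finite_measure set X -> \bar R}).

(** The induction must generalize the weight. With z_1 fixed, its factor joins the weight of the
    inner integrals ([w1]); once these are evaluated, their half steps and their constant form the
    weight of the outer one ([w2]). A single majorant serves throughout, since both |exp(z u)| and
    [half_step u] are at most exp(c u). The formula for [f] is required only on Re lambda = c, where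
    the Laplace transform is known. *)
Lemma is_iterated_vline_integral_laplace (m : nat) (c : 'cV[R]_m) (w : X -> R[i])
    (b : 'I_m -> X -> R) (g : X -> R) (f : 'cV[R[i]]_m -> R[i]) :
  (forall i, 0 < c i 0) -> cmeasurable w ->
  (forall i, measurable_fun setT (b i)) ->
  mu.-integrable setT (EFin \o g) ->
  (forall x, Normc.normc (w x) * \prod_(i < m) expR (c i 0 * b i x) <= g x) ->
  (forall l : 'cV[R[i]]_m, (forall i, complex.Re (l i 0) = c i 0) ->
    f l = cintegral mu setT (fun x => w x *
      \prod_(i < m) (cexp (l i 0 * (b i x)%:C) / l i 0))) ->
  is_iterated_vline_integral c f
    ((2 * pi%:C * 'i%C) ^+ m * cintegral mu setT (fun x => w x *
      \prod_(i < m) (half_step (b i x))%:C)).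
Proof.
elim: m c w b g f => [|k IH] c w b g f c0 mw mb ig wg fE.
  rewrite /= expr0 mul1r fE; last by case.
  by apply: eq_cintegral => x _; rewrite !big_ord0.
pose K : R[i] := (2 * pi%:C * 'i%C) ^+ k.
pose i0 : 'I_k.+1 := ord0.
pose s (j : 'I_k) : 'I_k.+1 := lift ord0 j.
have i0E : lshift k (ord0 : 'I_1) = i0 by exact: val_inj.
have sE j : rshift 1 j = s j by exact: val_inj.
pose b0 := b i0.
pose hp x : R[i] := \prod_(j < k) (half_step (b (s j) x))%:C.
have mhp : cmeasurable hp.
  apply: cmeasurable_prod => j; apply: cmeasurable_real.
  exact: (measurableT_comp (@measurable_half_step R) (mb _)).
have hple x : Normc.normc (hp x) <= \prod_(j < k) expR (c (s j) 0 * b (s j) x).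
  rewrite /hp normc_prod; apply: ler_prod => j _.
  by rewrite normc_real ger0_norm half_step_ge0 ?half_step_le_expR.
have c00 : 0 < c i0 0 by exact: c0.
have wsplit x : Normc.normc (w x) * (\prod_(j < k) expR (c (s j) 0 * b (s j) x)) *
    expR (c i0 0 * b0 x) <= g x.
  rewrite (le_trans _ (wg x))// big_ord_recl /= -/i0 -/b0.
  by rewrite -mulrA [X in _ * X]mulrC.
pose w2 x : R[i] := K * (w x * hp x).
have mw2 : cmeasurable w2.
  by apply: cmeasurableM; [exact: cmeasurable_cst|exact: cmeasurableM].
pose g2 x := Normc.normc K * g x.
have ig2 : mu.-integrable setT (EFin \o g2).
  exact: (integrableZl measurableT (Normc.normc K) ig).
have w2le x : Normc.normc (w2 x) * expR (c i0 0 * b0 x) <= g2 x.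
  rewrite /w2 !Normc.normcM -mulrA ler_wpM2l ?normc_ge0//.
  rewrite (le_trans _ (wsplit x))// ler_wpM2r ?expR_ge0//.
  by rewrite ler_wpM2l ?normc_ge0.
have main := is_vline_integral_laplace c00 mw2 (mb i0) ig2 w2le.
rewrite /=; exists (fun z => cintegral mu setT
    (fun x => w2 x * (cexp (z * (b0 x)%:C) / z))); last first.
  have -> : (2 * pi%:C * 'i%C) ^+ k.+1 * cintegral mu setT (fun x => w x *
      \prod_(i < k.+1) (half_step (b i x))%:C) =
      2 * pi%:C * 'i%C * cintegral mu setT (fun x => w2 x * (half_step (b i0 x))%:C).
    rewrite exprS -mulrA; congr (_ * _); rewrite -cintegralZ.
      apply: eq_cintegral => x _; rewrite /w2 -[RHS]mulrA -[X in _ = _ * X]mulrA.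
      congr (_ * (_ * _)); by rewrite big_ord_recl mulrC.
    apply: (cintegrable_le _ ig).
      apply: cmeasurableM => //; apply: cmeasurable_prod => i.
      apply: cmeasurable_real.
      exact: (measurableT_comp (@measurable_half_step R) (mb _)).
    move=> x; rewrite (le_trans _ (wg x))// Normc.normcM ler_wpM2l ?normc_ge0//.
    rewrite normc_prod; apply: ler_prod => j _.
    by rewrite normc_real ger0_norm half_step_ge0 ?half_step_le_expR.
  exact: main.
move=> t; set z := c 0 0 +i* t.
have zRe : complex.Re z = c i0 0 by [].
have z0 : 0 < complex.Re z by rewrite zRe.
pose w1 x : R[i] := w x * (cexp (z * (b0 x)%:C) / z).
have mw1 : cmeasurable w1.
  apply: cmeasurableM => //; apply: cmeasurableM; last exact: cmeasurable_cst.
  apply: cmeasurable_cexp; apply: cmeasurableM; first exact: cmeasurable_cst.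
  by apply: cmeasurable_real; exact: mb.
pose g1 x := (c i0 0)^-1 * g x.
have ig1 : mu.-integrable setT (EFin \o g1).
  exact: (integrableZl measurableT (c i0 0)^-1 ig).
have w1le x : Normc.normc (w1 x) * \prod_(j < k) expR (c (s j) 0 * b (s j) x) <= g1 x.
  rewrite /w1 Normc.normcM [Normc.normc (_ / z)]Normc.normcM normc_cexp Re_Mreal zRe Normc.normcV.
  rewrite mulrA mulrAC [leLHS]mulrC ler_pM//.
  - by rewrite invr_ge0 normc_ge0.
  - by rewrite !mulr_ge0 ?normc_ge0 ?expR_ge0//; apply: prodr_ge0 => j _; exact: expR_ge0.
  - by rewrite -zRe; exact: normcV_le_ReV.
  - by rewrite mulrAC.
have -> : cintegral mu setT (fun x => w2 x * (cexp (z * (b0 x)%:C) / z)) =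
    K * cintegral mu setT (fun x => w1 x * hp x).
  rewrite -cintegralZ.
    by apply: eq_cintegral => x _; rewrite /w2 /w1; ring.
  apply: (cintegrable_le _ ig1); first exact: cmeasurableM.
  move=> x; rewrite (le_trans _ (w1le x))// Normc.normcM.
  by rewrite ler_wpM2l ?normc_ge0.
pose zl (l : 'cV[R[i]]_k) : 'cV[R[i]]_k.+1 := col_mx (z%:M : 'cV[R[i]]_1) l.
have zlu l : zl l i0 0 = z.
  by rewrite -i0E; apply: (etrans (col_mxEu _ _ _ _)); rewrite mxE eqxx.
have zld l j : zl l (s j) 0 = l j 0.
  by rewrite -sE; exact: col_mxEd.
apply: (IH (dsubmx (c : 'cV[R]_(1 + k))) w1 (fun j => b (s j)) g1
  (fun l => f (col_mx (z%:M : 'cV[R[i]]_1) l))) => //.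
- by move=> j; rewrite mxE sE.
- by move=> x; under eq_bigr do rewrite mxE sE; exact: w1le.
- move=> l lRe; rewrite -/(zl l) fE.
    apply: eq_cintegral => x _; rewrite /w1 -mulrA; congr (_ * _).
    rewrite big_ord_recl zlu; congr (_ * _).
    by apply: eq_bigr => j _; rewrite zld.
  move=> i; have [->|[j ->]] : i = i0 \/ exists j, i = s j.
      by case: (unliftP ord0 i) => [j ->|->]; [right; exists j|left].
    by rewrite zlu zRe.
  by rewrite zld lRe mxE sE.
Qed.

End iterated_bromwich.

(** * The volume of the polyhedron *)

Section polyhedron_laplace.
Variables (R : realType) (m n : nat) (A : 'M[R]_(m, n)).
Local Notation mR := (measurableTypeR R).

Definition lin_form (v : 'I_n -> R) (t : n.-tuple mR) : R := \sum_(j < n) v j * tnth t j.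

Lemma measurable_lin_form v : measurable_fun setT (lin_form v).
Proof.
apply: measurable_sum => j; apply: measurable_funM => //.
exact: measurable_tnth.
Qed.

Definition row_form (i : 'I_m) : n.-tuple mR -> R := lin_form (A i).

Lemma row_formE i t : (A *m col_of_tuple t) i 0 = row_form i t.
Proof. by rewrite mxE; apply: eq_bigr => j _; rewrite mxE. Qed.

(** A product of coordinate indicators, so that integrals over the orthant split into
    one-dimensional ones. *)
Definition orthant (t : n.-tuple mR) : R := \prod_(j < n) (0 <= tnth t j)%R%:R.

Lemma orthant_ge0 t : 0 <= orthant t.
Proof. by apply: prodr_ge0 => j _; rewrite ler0n. Qed.

Lemma measurable_orthant : measurable_fun setT orthant.
Proof.
apply: measurable_prod => j _; apply: measurable_natr_bool.
apply: measurable_fun_ler; first exact: measurable_cst.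
exact: measurable_tnth.
Qed.

(** Transposition, <lambda, Ax> = <A'lambda, x>, is what separates the coordinates of x. *)
Lemma prod_cexp_row_form (l : 'cV[R[i]]_m) (t : n.-tuple mR) :
  (orthant t)%:C * \prod_(i < m) cexp (- (l i 0 * (row_form i t)%:C)) =
  \prod_(j < n) exp_step (ctrmul A l j 0) 0 (tnth t j).
Proof.
rewrite /exp_step [RHS]big_split [RHS]mulrC; congr (_ * _); first exact: rmorph_prod.
rewrite -(cexp_sum _ (fun i => - (l i 0 * (row_form i t)%:C))).
rewrite -(cexp_sum _ (fun j => - (ctrmul A l j 0 * (tnth t j)%:C))); congr cexp.
under eq_bigr => i _ do rewrite /row_form /lin_form rmorph_sum mulr_sumr -sumrN.
rewrite exchange_big; apply: eq_bigr => j _ /=.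
rewrite /ctrmul mxE mulr_suml -sumrN; apply: eq_bigr => i _.
by rewrite !mxE rmorphM; congr (- _); ring.
Qed.

Lemma cintegral_orthant (l : 'cV[R[i]]_m) :
  (forall j, 0 < complex.Re (ctrmul A l j 0)) ->
  cintegrable (tuple_lebesgue n) setT
    (fun t => (orthant t)%:C * \prod_(i < m) cexp (- (l i 0 * (row_form i t)%:C))) /\
  cintegral (tuple_lebesgue n) setT
    (fun t => (orthant t)%:C * \prod_(i < m) cexp (- (l i 0 * (row_form i t)%:C))) =
    1 / \prod_(j < n) ctrmul A l j 0.
Proof.
move=> l0; rewrite (funext (prod_cexp_row_form l)).
have ex j := cintegral_exp_step 0 (l0 j).
have [it eqt] := cintegral_tuple_prod (fun j => (ex j).1).
split; first exact: it.
rewrite [LHS]eqt div1r -prodfV; apply: eq_bigr => j _.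
by rewrite (ex j).2 mulr0 oppr0 cexp0 div1r.
Qed.

Lemma cexp_real (x : R) : cexp x%:C = (expR x)%:C.
Proof.
rewrite /cexp /= cos0 sin0; apply/eqP; rewrite eq_complex /=.
by apply/andP; split; apply/eqP; ring.
Qed.

Lemma exp_step_real (c b s : R) :
  exp_step c%:C b s = (expR (- (c * s)) * (b <= s)%R%:R)%:C.
Proof. by rewrite /exp_step -rmorphM -rmorphN cexp_real -rmorphM. Qed.

(** The complex computation at the real point lambda = c. The dominations in x that follow all come
    down to this function. *)
Lemma integrable_orthant (c : 'cV[R]_m) : (forall j, 0 < (A^T *m c) j 0) ->
  (tuple_lebesgue n).-integrable setT
    (EFin \o (fun t => orthant t * \prod_(i < m) expR (- (c i 0 * row_form i t)))).
Proof.
move=> c0; pose l : 'cV[R[i]]_m := map_mx (real_complex R) c.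
have lE j : ctrmul A l j 0 = ((A^T *m c) j 0)%:C.
  rewrite /ctrmul !mxE rmorph_sum; apply: eq_bigr => i _.
  by rewrite !mxE rmorphM.
have [|[iR _] _] := @cintegral_orthant l.
  by move=> j; rewrite lE; exact: c0.
apply: eq_integrable iR => // t _ /=.
under eq_bigr do rewrite /l mxE -rmorphM -rmorphN cexp_real.
by rewrite -rmorph_prod -rmorphM.
Qed.

Definition sublevel (y : 'I_m -> R) (t : n.-tuple mR) : R :=
  \prod_(i < m) (row_form i t <= y i)%R%:R.

Lemma sublevel_ge0 y t : 0 <= sublevel y t.
Proof. by apply: prodr_ge0 => j _; rewrite ler0n. Qed.

Lemma measurable_sublevel y : measurable_fun setT (sublevel y).
Proof.
apply: measurable_prod => i _; apply: measurable_natr_bool.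
apply: measurable_fun_ler; last exact: measurable_cst.
exact: measurable_lin_form.
Qed.

Lemma prodr_natb (I : finType) (b : pred I) :
  \prod_i (b i)%:R = [forall i, b i]%:R :> R.
Proof.
case: forallP => [h|/forallP].
  by rewrite big1// => i _; rewrite h.
rewrite negb_forall => /existsP[i /negbTE bi].
by rewrite (bigD1 i)//= bi mul0r.
Qed.

Lemma vol_OmegaE (y : 'cV[R]_m) : vol_Omega A y =
  \int[tuple_lebesgue n]_t (orthant t * sublevel (fun i => y i 0) t).
Proof.
pose S := [set t : n.-tuple mR | Omega A y (col_of_tuple t)].
have SE : (fun t => orthant t * sublevel (fun i => y i 0) t) = (\1_S : _ -> R).
  apply/funext => t; rewrite /orthant /sublevel !prodr_natb -natrM mulnb indicE.
  congr (_%:R); congr nat_of_bool; apply/idP/idP.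
    case/andP => /forallP h1 /forallP h2; rewrite inE; split => [j|i].
      by rewrite mxE.
    by rewrite row_formE.
  rewrite inE => -[h1 h2]; apply/andP; split; apply/forallP => j.
    by have := h1 j; rewrite mxE.
  by have := h2 j; rewrite row_formE.
have mS : measurable S.
  apply/(@measurable_indicP _ _ R); rewrite -SE; apply: measurable_funM.
    exact: measurable_orthant.
  exact: measurable_sublevel.
by rewrite SE /Rintegral integral_indic// setIT.
Qed.

End polyhedron_laplace.

(** * The Laplace transform of the volume *)

Section laplace_formula.
Variables (R : realType) (m n : nat) (A : 'M[R]_(m, n)).
Local Notation mR := (measurableTypeR R).
Local Notation leb := (@lebesgue_measure R).

Lemma sublevel_le (c : 'cV[R]_m) (y : 'I_m -> R) (t : n.-tuple mR) :
  (forall i, 0 < c i 0) ->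
  sublevel A y t <= (\prod_(i < m) expR (c i 0 * y i)) *
    \prod_(i < m) expR (- (c i 0 * row_form A i t)).
Proof.
move=> c0; rewrite -big_split /=; apply: ler_prod => i _; rewrite ler0n /=.
by rewrite -expRD -mulrBr -[(row_form A i t <= y i)%R]subr_ge0 step_le_expR.
Qed.

(** On the polyhedron exp(<c, y - Ax>) >= 1 because c > 0, and A'c > 0 makes this exponential
    integrable over the orthant. *)
Lemma integrable_orthant_sublevel (c : 'cV[R]_m) (y : 'I_m -> R) :
  (forall i, 0 < c i 0) -> (forall j, 0 < (A^T *m c) j 0) ->
  (tuple_lebesgue n).-integrable setT
    (EFin \o (fun t => orthant t * sublevel A y t)).
Proof.
move=> c0 Ac0.
have ig := integrable_orthant Ac0.
apply: (le_integrable _ _ _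
  (integrableZl measurableT (\prod_(i < m) expR (c i 0 * y i)) ig)) => //.
  apply/measurable_EFinP/measurable_funM; first exact: measurable_orthant.
  exact: measurable_sublevel.
move=> t _ /=; rewrite lee_fin.
have P0 : 0 <= \prod_(i < m) expR (c i 0 * y i).
  by apply: prodr_ge0 => i _; exact: expR_ge0.
have Q0 : 0 <= \prod_(i < m) expR (- (c i 0 * row_form A i t)).
  by apply: prodr_ge0 => i _; exact: expR_ge0.
rewrite ger0_norm ?mulr_ge0 ?orthant_ge0 ?sublevel_ge0//.
rewrite ger0_norm ?mulr_ge0 ?orthant_ge0// mulrCA ler_wpM2l ?orthant_ge0//.
exact: sublevel_le.
Qed.

Lemma cintegral_exp_step_tuple (l : 'I_m -> R[i]) (b : 'I_m -> R) :
  (forall i, 0 < complex.Re (l i)) ->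
  cintegrable (tuple_lebesgue m) setT
    (fun y : m.-tuple mR => \prod_(i < m) exp_step (l i) (b i) (tnth y i)) /\
  cintegral (tuple_lebesgue m) setT
    (fun y : m.-tuple mR => \prod_(i < m) exp_step (l i) (b i) (tnth y i)) =
  \prod_(i < m) (cexp (- (l i * (b i)%:C)) / l i).
Proof.
move=> l0; have ex i := cintegral_exp_step (b i) (l0 i).
have [it eqt] := cintegral_tuple_prod (fun i => (ex i).1).
split; first exact: it.
by rewrite [LHS]eqt; apply: eq_bigr => i _; rewrite (ex i).2.
Qed.

Lemma cintegral_real d (T : measurableType d) (mu : {measure set T -> \bar R})
  (f : T -> R) : cintegral mu setT (fun x => (f x)%:C) = (\int[mu]_x f x)%:C.
Proof.
by rewrite /cintegral /= Rintegral_cst// mul0r.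
Qed.

Lemma cintegrable_real d (T : measurableType d) (mu : {measure set T -> \bar R})
  (f : T -> R) : mu.-integrable setT (EFin \o f) ->
  cintegrable mu setT (fun x => (f x)%:C).
Proof. by move=> fi; split => //=; exact: integrable0. Qed.

Lemma normc_exp_step (l : R[i]) (b s : R) : Normc.normc (exp_step l b s) =
  expR (- (complex.Re l * s)) * (b <= s)%R%:R.
Proof.
rewrite /exp_step Normc.normcM normc_cexp normc_real ger0_norm ?ler0n//.
by congr (expR _ * _); rewrite -Re_Mreal; case: (l * _).
Qed.

(* The integrand of the Laplace transform before integration in x. *)
Definition laplace_joint (l : 'I_m -> R[i]) (z : m.-tuple mR * n.-tuple mR) : R[i] :=
  (orthant z.2)%:C * \prod_(i < m) exp_step (l i) (row_form A i z.2) (tnth z.1 i).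

Lemma cmeasurable_laplace_joint l : cmeasurable (laplace_joint l).
Proof.
have mt i : measurable_fun setT (fun z : m.-tuple mR * n.-tuple mR => tnth z.1 i).
  exact: (measurableT_comp (measurable_tnth i) measurable_fst).
apply: cmeasurableM.
  apply: cmeasurable_real.
  exact: (measurableT_comp (@measurable_orthant R n) measurable_snd).
apply: cmeasurable_prod => i; apply: cmeasurableM.
  apply: cmeasurable_cexp.
  have -> : (fun x : m.-tuple mR * n.-tuple mR => - (l i * (tnth x.1 i)%:C)) =
     (fun x => - l i * (tnth x.1 i)%:C).
    by apply/funext => x; rewrite mulNr.
  apply: cmeasurableM; first exact: cmeasurable_cst.
  by apply: cmeasurable_real; exact: mt.
apply: cmeasurable_real; apply: measurable_natr_bool.
apply: measurable_fun_ler; last exact: mt.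
exact: (measurableT_comp (measurable_lin_form _) measurable_snd).
Qed.

Lemma normc_laplace_joint l z : Normc.normc (laplace_joint l z) =
  orthant z.2 * \prod_(i < m) (expR (- (complex.Re (l i) * tnth z.1 i)) *
    (row_form A i z.2 <= tnth z.1 i)%R%:R).
Proof.
rewrite /laplace_joint Normc.normcM normc_real ger0_norm ?orthant_ge0//.
by rewrite normc_prod; congr (_ * _); apply: eq_bigr => i _; rewrite normc_exp_step.
Qed.

(* The modulus of [laplace_joint l] is not dominated by a product f(y) g(x):
   integrability comes from Tonelli, integrating in y first. *)
Lemma cintegrable_laplace_joint (c : 'cV[R]_m) (l : 'I_m -> R[i]) :
  (forall i, complex.Re (l i) = c i 0) ->
  (forall i, 0 < c i 0) -> (forall j, 0 < (A^T *m c) j 0) ->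
  cintegrable (tuple_lebesgue m \x tuple_lebesgue n)%E setT (laplace_joint l).
Proof.
move=> lc c0 Ac0.
(* The modulus of the integrand at lambda is the integrand at the real point c = Re lambda, so that
   its y-integral is again explicit. *)
pose rho z := complex.Re (laplace_joint (fun i => (c i 0)%:C) z).
have jE z : laplace_joint (fun i => (c i 0)%:C) z = (rho z)%:C.
  rewrite /rho /laplace_joint; under eq_bigr do rewrite exp_step_real.
  by rewrite -rmorph_prod -rmorphM.
have rhoE z : rho z = Normc.normc (laplace_joint l z).
  rewrite normc_laplace_joint /rho /laplace_joint.
  under eq_bigr do rewrite exp_step_real.
  rewrite -rmorph_prod -rmorphM /=; congr (_ * _).
  by apply: eq_bigr => i _; rewrite lc.
have rho0 z : 0 <= rho z by rewrite rhoE normc_ge0.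
apply: (@cintegrable_le _ _ _ _ _ rho) => //; first exact: cmeasurable_laplace_joint.
  apply/integrable21ltyP => /=.
    apply/measurable_EFinP.
    by case: (cmeasurable_laplace_joint (fun i => (c i 0)%:C)).
  have ex x := @cintegral_exp_step_tuple (fun i => (c i 0)%:C)
    (fun i => row_form A i x) c0.
  have secE x y : rho (y, x) = complex.Re ((orthant x)%:C *
      \prod_(i < m) exp_step (c i 0)%:C (row_form A i x) (tnth y i)) by [].
  have sec x : (\int[tuple_lebesgue m]_y `|(rho (y, x))%:E|)%E =
    ((\prod_(i < m) (c i 0)^-1) *
      (orthant x * \prod_(i < m) expR (- (c i 0 * row_form A i x))))%:E.
    have [iR _] := cintegrableZ (orthant x)%:C (ex x).1.
    under eq_integral do rewrite /= ger0_norm// secE.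
    rewrite -[LHS]fineK; last exact: (integrable_fin_num measurableT iR).
    congr EFin.
    transitivity (complex.Re (cintegral (tuple_lebesgue m) setT
      (fun y => (orthant x)%:C *
      \prod_(i < m) exp_step (c i 0)%:C (row_form A i x) (tnth y i)))) => //.
    rewrite (cintegralZ _ (ex x).1) (ex x).2.
    under eq_bigr do rewrite -rmorphM -rmorphN cexp_real -fmorphV -rmorphM.
    rewrite -rmorph_prod -rmorphM /= big_split /=; ring.
  under eq_integral do rewrite sec.
  have fin := integrable_fin_num measurableT
    (integrableZl measurableT (\prod_(i < m) (c i 0)^-1) (integrable_orthant Ac0)).
  by move: fin; rewrite fin_numE => /andP[_ ?]; rewrite ltey.
by move=> z; rewrite rhoE.
Qed.

Lemma laplace_vol_Omega (l : 'cV[R[i]]_m) :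
  (forall i, 0 < complex.Re (l i 0)) ->
  (forall j, 0 < complex.Re (ctrmul A l j 0)) ->
  laplace_converges (vol_Omega A) l /\
  laplace (vol_Omega A) l =
    1 / (\prod_(i < m) l i 0) * (1 / \prod_(j < n) ctrmul A l j 0).
Proof.
move=> l0 Al0.
pose c : 'cV[R]_m := \col_i complex.Re (l i 0).
have c0 i : 0 < c i 0 by rewrite mxE.
have Ac0 j : 0 < (A^T *m c) j 0.
  rewrite (_ : _ j 0 = complex.Re (ctrmul A l j 0))// /ctrmul !mxE Re_sum.
  by apply: eq_bigr => i _; rewrite !mxE ReM /= mul0r subr0.
have lc i : complex.Re (l i 0) = c i 0 by rewrite mxE.
have iJ := cintegrable_laplace_joint lc c0 Ac0.
have jE y x : laplace_joint (fun i => l i 0) (y, x) =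
    cexp (- pairing l (col_of_tuple y)) *
    (orthant x * sublevel A (fun i => (col_of_tuple y) i 0) x)%:C.
  rewrite /laplace_joint /exp_step big_split /= rmorphM mulrCA; congr (_ * (_ * _)).
    rewrite -(cexp_sum _ (fun i => - (l i 0 * (tnth y i)%:C))) /pairing sumrN.
    by congr (cexp (- _)); apply: eq_bigr => i _; rewrite mxE.
  by rewrite rmorph_prod; apply: eq_bigr => i _; rewrite mxE.
have isl y := cintegrable_real (integrable_orthant_sublevel y c0 Ac0).
have sec1 y : cintegrable (tuple_lebesgue n) setT
    (fun x => laplace_joint (fun i => l i 0) (y, x)).
  rewrite (funext (jE y)); exact: cintegrableZ.
have ex x := @cintegral_exp_step_tuple (fun i => l i 0)
  (fun i => row_form A i x) l0.
have sec2 x : cintegrable (tuple_lebesgue m) setT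
    (fun y => laplace_joint (fun i => l i 0) (y, x)).
  exact: (cintegrableZ (orthant x)%:C (ex x).1).
have [i1 e1] := cintegral_fubini1 iJ sec1.
have [_ e2] := cintegral_fubini2 iJ sec2.
(* Integrating in x first recovers the Laplace integrand; integrating in y first gives the product
   formula. *)
have inE : laplace_integrand (vol_Omega A) l =
    (fun y => cintegral (tuple_lebesgue n) setT
      (fun x => laplace_joint (fun i => l i 0) (y, x))).
  apply/funext => y; rewrite (funext (jE y)) cintegralZ// cintegral_real.
  by rewrite /laplace_integrand vol_OmegaE.
rewrite /laplace_converges /laplace inE; split; first exact: i1.
rewrite [LHS]e1 -[LHS]e2.
have [iO eO] := cintegral_orthant Al0.
rewrite -eO -(cintegralZ _ iO); apply: eq_cintegral => x _.
transitivity ((orthant x)%:C * \prod_(i < m)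
    (cexp (- (l i 0 * (row_form A i x)%:C)) / l i 0)).
  by rewrite -(ex x).2 -(cintegralZ _ (ex x).1).
by rewrite big_split /= prodfV; ring.
Qed.

End laplace_formula.

(** * From half steps back to the volume *)

Section inversion.
Variable R : realType.
Local Notation mR := (measurableTypeR R).
Local Notation leb := (@lebesgue_measure R).

(** Slicing along the first coordinate: if another coefficient is nonzero, each slice is a
    hyperplane one dimension lower; otherwise the slices are empty for all but one x. *)
Lemma tuple_lebesgue_hyperplane (n : nat) (v : 'I_n -> R) (a : R) :
  (exists j, v j != 0) ->
  tuple_lebesgue n [set t | lin_form v t = a] = 0%E.
Proof.
elim: n v a => [|n IH] v a; first by move=> [[]].
move=> [j vj].
have secE x : [set t : n.-tuple mR | [set t | lin_form v t = a] (cons_tuple x t)] =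
    [set t | lin_form (fun i => v (lift ord0 i)) t = a - v ord0 * x].
  apply/seteqP; split => t /=; rewrite /lin_form big_ord_recl tnth0.
    by under eq_bigr do rewrite tnthS; move=> <-; rewrite addrC addKr.
  by under [in X in _ -> X]eq_bigr do rewrite tnthS; move=> ->; rewrite addrC subrK.
rewrite /=; under eq_integral do rewrite secE.
have [[k vk]|nov] := pselect (exists k : 'I_n, v (lift ord0 k) != 0).
  by apply: integral0_eq => x _; apply: IH; exists k.
have v0 k : v (lift ord0 k) = 0.
  by apply/eqP; apply/negPn/negP => h; apply: nov; exists k.
have vo : v ord0 != 0.
  by move: vj; case: (unliftP ord0 j) => [k ->|->//]; rewrite v0 eqxx.
(* Only the slice at x = a / v_0 can be nonempty, so the integral is compared with one over that
   single point. *)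
rewrite -(integral_set1 (fun x : R => tuple_lebesgue n
  [set t | lin_form (fun i => v (lift ord0 i)) t = a - v ord0 * x]) (a / v ord0)).
rewrite [RHS]integral_mkcond; apply: eq_integral => x _.
rewrite patchE; case: ifPn => // /negP xa.
rewrite (_ : [set t | _] = set0) ?measure0//.
apply/seteqP; split => // t /=; rewrite /lin_form big1 => [h|k _]; last by rewrite v0 mul0r.
apply: xa; rewrite inE /=.
have -> : a = v ord0 * x by apply/eqP; rewrite -subr_eq0 -h.
by rewrite mulrC mulKf.
Qed.

Variables (m n : nat) (A : 'M[R]_(m, n)).

Definition half_sublevel (y : 'I_m -> R) (t : n.-tuple mR) : R :=
  \prod_(i < m) half_step (y i - row_form A i t).

Lemma half_sublevel_le y t : half_sublevel y t <= sublevel A y t.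
Proof.
apply: ler_prod => i _; rewrite half_step_ge0/=.
by rewrite (le_trans (half_step_le _))// subr_ge0.
Qed.

Lemma sublevel_shift_le y (e : R) t : 0 < e ->
  sublevel A (fun i => y i - e) t <= half_sublevel y t.
Proof.
move=> e0; apply: ler_prod => i _; rewrite ler0n/=.
rewrite (le_trans _ (half_step_ge _))// ler_nat subr_gt0.
by case: (leP (row_form A i t) (y i - e)) => // h; rewrite lt0b (le_lt_trans h)// ltrBlDr ltrDl.
Qed.

Lemma half_sublevel_ge0 y t : 0 <= half_sublevel y t.
Proof. by apply: prodr_ge0 => i _; exact: half_step_ge0. Qed.

Lemma measurable_half_sublevel y : measurable_fun setT (half_sublevel y).
Proof.
apply: measurable_prod => i _.
apply: (measurableT_comp (@measurable_half_step R)).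
apply: measurable_funB; first exact: measurable_cst.
exact: measurable_lin_form.
Qed.

Variable c : 'cV[R]_m.
Hypotheses (c0 : forall i, 0 < c i 0) (Ac0 : forall j, 0 < (A^T *m c) j 0).

Let integrable_half y : (tuple_lebesgue n).-integrable setT
  (EFin \o (fun t => orthant t * half_sublevel y t)).
Proof.
apply: (le_integrable _ _ _ (integrable_orthant_sublevel y c0 Ac0)) => //.
  apply/measurable_EFinP/measurable_funM; first exact: measurable_orthant.
  exact: measurable_half_sublevel.
move=> t _ /=; rewrite lee_fin.
rewrite !ger0_norm ?mulr_ge0 ?orthant_ge0 ?sublevel_ge0 ?half_sublevel_ge0//.
by rewrite ler_wpM2l ?orthant_ge0// half_sublevel_le.
Qed.

(** The danger is a zero row i with y_i = 0: it contributes the constant factor [half_step 0] = 1/2,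
    whereas the volume is unaffected by the constraint 0 <= 0 and drops to 0 for y_i < 0. Each
    alternative of the hypothesis removes the resulting discrepancy. *)
Lemma vol_Omega_half (y : 'cV[R]_m) :
  (forall i, row i A != 0) \/ {for y, continuous (vol_Omega A)} ->
  vol_Omega A y =
    \int[tuple_lebesgue n]_t (orthant t * half_sublevel (fun i => y i 0) t).
Proof.
pose g y := \int[tuple_lebesgue n]_t (orthant t * half_sublevel y t).
have vol_ge : g (fun i => y i 0) <= vol_Omega A y.
  rewrite vol_OmegaE; apply: le_Rintegral => //.
    exact: integrable_orthant_sublevel c0 Ac0.
  by move=> t _; rewrite ler_wpM2l ?orthant_ge0// half_sublevel_le.
case=> [A0|cy]; last first.
  apply/eqP; rewrite eq_le; apply/andP; split; last exact: vol_ge.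
  apply/ler_addgt0Pr => e e0.
  have /cvgrPdist_lt /(_ _ e0) := cy.
  move=> /nbhs_ballP[d /= d0 dy].
  pose y' := y - const_mx (d / 2).
  have d2 : 0 < d / 2 by rewrite divr_gt0.
  have : `|vol_Omega A y - vol_Omega A y'| < e.
    apply: dy; split=> // i j; rewrite /y' !mxE /ball /= opprB addrCA subrr addr0.
    by rewrite gtr0_norm// ltr_pdivrMr// ltr_pMr// ltr1n.
  have : vol_Omega A y' <= g (fun i => y i 0).
    rewrite vol_OmegaE; apply: le_Rintegral => //.
      exact: integrable_orthant_sublevel c0 Ac0.
    move=> t _; rewrite ler_wpM2l ?orthant_ge0//.
    rewrite (le_trans _ (sublevel_shift_le _ _ d2))// /sublevel.
    by under eq_bigr do rewrite !mxE.
  rewrite -/(g _) ltr_norml => h /andP[_]; rewrite ltrBlDr => h'.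
  by rewrite (le_trans (ltW h'))// addrC lerD2r.
rewrite vol_OmegaE; apply/eqP; rewrite /Rintegral; apply/eqP; congr fine.
apply: ae_eq_integral => //.
- apply: (measurable_int _ (integrable_orthant_sublevel _ c0 Ac0)).
- apply: (measurable_int _ (integrable_half _)).
pose N i := [set t : n.-tuple mR | lin_form (A i) t = y i 0].
have mN i : measurable (N i).
  have := @measurable_lin_form R n (A i) measurableT [set y i 0] (measurable_set1 _).
  by rewrite setTI.
have : {ae tuple_lebesgue n, forall t, forall i, ~ N i t}.
  apply: filter_forall => i; exists (N i); split => //; last first.
    by move=> t /= /contrapT.
  apply: tuple_lebesgue_hyperplane.
  by have /rV0Pn[j] := A0 i; rewrite mxE => Aij; exists j.
apply: filterS => t tN _; congr EFin; congr (_ * _).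
apply: eq_bigr => i _; rewrite /half_step subr_ge0 subr_gt0.
have [h|h|h] := ltgtP (row_form A i t) (y i 0).
- by rewrite /= -mulr2n -mulr_natr mul1r divff.
- by rewrite addr0 mul0r.
- by exfalso; exact: (tN i h).
Qed.

Lemma laplace_inversion (y : 'cV[R]_m) :
  (forall i, row i A != 0) \/ {for y, continuous (vol_Omega A)} ->
  exists2 I : R[i],
    is_iterated_vline_integral c
      (fun l => cexp (pairing l y) * laplace (vol_Omega A) l) I &
    (vol_Omega A y)%:C = 1 / (2 * pi%:C * 'i%C) ^+ m * I.
Proof.
move=> Ay.
pose b i (t : n.-tuple mR) := y i 0 - row_form A i t.
pose w (t : n.-tuple mR) : R[i] := (orthant t)%:C.
pose P := \prod_(i < m) expR (c i 0 * y i 0).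
pose g (t : n.-tuple mR) := P * (orthant t * \prod_(i < m) expR (- (c i 0 * row_form A i t))).
have mw : cmeasurable w by apply: cmeasurable_real; exact: measurable_orthant.
have mb i : measurable_fun setT (b i).
  apply: measurable_funB; first exact: measurable_cst.
  exact: measurable_lin_form.
have ig : (tuple_lebesgue n).-integrable setT (EFin \o g).
  exact: (integrableZl measurableT P (integrable_orthant Ac0)).
have wg t : Normc.normc (w t) * \prod_(i < m) expR (c i 0 * b i t) <= g t.
  rewrite normc_real ger0_norm ?orthant_ge0// /g mulrCA -big_split /=.
  rewrite le_eqVlt; apply/orP; left; apply/eqP; congr (_ * _).
  by apply: eq_bigr => i _; rewrite -expRD -mulrBr.
have := is_iterated_vline_integral_laplace c0 mw mb ig wg
  (f := fun l => cexp (pairing l y) * laplace (vol_Omega A) l).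
set J := _ * cintegral _ _ _ => H.
exists J.
  apply: H => l lc.
  have l0 i : 0 < complex.Re (l i 0) by rewrite lc.
  have Al0 j : 0 < complex.Re (ctrmul A l j 0).
    rewrite (_ : complex.Re _ = (A^T *m c) j 0)// /ctrmul !mxE Re_sum.
    by apply: eq_bigr => i _; rewrite !mxE ReM /= mul0r subr0 lc.
  have [_ ->] := laplace_vol_Omega l0 Al0.
  (* The factor 1 / prod (A'lambda)_j is turned back into an integral over the orthant, which
     exposes the product of the exp(lambda_i b_i) / lambda_i. *)
  have [iO <-] := cintegral_orthant Al0.
  rewrite mulrA -(cintegralZ _ iO); apply: eq_cintegral => t _.
  rewrite mulrCA; congr (_ * _).
  rewrite /pairing cexp_sum div1r -prodfV -!big_split /=; apply: eq_bigr => i _.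
  rewrite /b rmorphB mulrBr cexpD; ring.
have two_pi_i : 2 * pi%:C * 'i%C != 0 :> R[i].
  rewrite !mulf_neq0//.
    by apply/negP => /eqP [] /eqP; rewrite (gt_eqF (pi_gt0 R)).
  by apply/negP => /eqP [] /eqP; rewrite oner_eq0.
rewrite /J mulrA div1r mulVf ?expf_neq0// mul1r (vol_Omega_half Ay) -cintegral_real.
apply: eq_cintegral => t _; rewrite rmorphM; congr (_ * _).
exact: rmorph_prod.
Qed.

End inversion.

Theorem theorem2p1 (R : realType) (m n : nat) (A : 'M[R]_(m, n))
    (Omega_compact : forall y : 'cV[R]_m, compact (Omega A y))
    (only0 : forall x : 'cV[R]_n,
       (forall j, 0 <= x j 0) -> (forall i, (A *m x) i 0 <= 0) -> x = 0) :
  (forall l : 'cV[R[i]]_m,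
     (forall i, 0 < complex.Re (l i 0)) ->
     (forall j, 0 < complex.Re (ctrmul A l j 0)) ->
     laplace_converges (vol_Omega A) l /\
     laplace (vol_Omega A) l =
       1 / (\prod_(i < m) l i 0) * (1 / \prod_(j < n) ctrmul A l j 0)) /\
  (forall c : 'cV[R]_m,
     (forall i, 0 < c i 0) ->
     (forall j, 0 < (A^T *m c) j 0) ->
     forall y : 'cV[R]_m,
       (forall i, row i A != 0) \/ {for y, continuous (vol_Omega A)} ->
       exists2 I : R[i],
         is_iterated_vline_integral c
           (fun l => cexp (pairing l y) * laplace (vol_Omega A) l) I &
         (vol_Omega A y)%:C = 1 / (2 * pi%:C * 'i%C) ^+ m * I).
Proof.
split; first exact: laplace_vol_Omega.
by move=> c c0 Ac0 y; exact: laplace_inversion.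
Qed.
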